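(* Let $\mathcal{S}_1$ and $\mathcal{S}_2$ be two descriptional systems, with associated complexity measures $c_1$ and $c_2$, and let $f:\mathbb{N}\to\mathbb{N}$ be a total function that serves as an upper bound for the increase in complexity when changing from a descriptor in $\mathcal{S}_1$ to an equivalent descriptor in $\mathcal{S}_2$. Then: (1) If both descriptional systems are recursive and $f\leq_T\emptyset'$, then the $\mathcal{S}_2$-ness of $\mathcal{S}_1$ descriptors is recursive in $\emptyset'$. (2) If at least one descriptional system is not recursive (but recursively enumerable) and $f\leq_T\emptyset''$, then the $\mathcal{S}_2$-ness of $\mathcal{S}_1$ descriptors is recursive in $\emptyset''$.
   Context: A descriptional system $\mathcal{S}$ is a recursive set of non-empty finite descriptors, such that each descriptor $D\in\mathcal{S}$ describes a formal language $L(D)$, and if $L(D)$ is recursive (recursively enumerable), then there exists an effective procedure to convert $D$ into a Turing machine that decides (semi-decides) $L(D)$. The system is called recursive (recursively enumerable) if all the languages $L(D)$, $D\in\mathcal{S}$, are recursive (recursively enumerable); every descriptional system is taken to be at most recursively enumerable, i.e. all languages it describes are recursively enumerable. Put $\mathscr{L}(\mathcal{S})=\{L(D)\mid D\in\mathcal{S}\}$ and $\mathcal{S}(L)=\{D\in\mathcal{S}\mid L(D)=L\}$. A complexity measure for $\mathcal{S}$ is a total recursive function $c:\mathcal{S}\to\mathbb{N}$ such that for any alphabet $A$, the set of descriptors in $\mathcal{S}$ describing languages over $A$ is recursively enumerable in order of increasing size, and does not contain infinitely many descriptors of the same size. Whenever two systems are compared, $\mathscr{L}(\mathcal{S}_1)\cap\mathscr{L}(\mathcal{S}_2)$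 is assumed to be non-empty. A total function $f:\mathbb{N}\to\mathbb{N}$ with $f(n)\ge n$ is an upper bound for the increase in complexity when changing from a descriptor in $\mathcal{S}_1$ to an equivalent descriptor in $\mathcal{S}_2$ if for all $D_1\in\mathcal{S}_1$ with $L(D_1)\in\mathscr{L}(\mathcal{S}_2)$ there exists $D_2\in\mathcal{S}_2(L(D_1))$ such that $c_2(D_2)\le f(c_1(D_1))$. The $\mathcal{S}_2$-ness of $\mathcal{S}_1$ descriptors is the problem: given a descriptor $D_1\in\mathcal{S}_1$, does the language $L(D_1)$ belong to $\mathscr{L}(\mathcal{S}_2)$? $\leq_T$ is Turing reducibility ($f\le_T B$ means that $f$ is computable by a Turing machine with oracle $B$), and $\emptyset',\emptyset''$ are the first and second jumps of $\emptyset$. *)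

(* Defs.v *)
From mathcomp Require Import all_boot.
From mathcomp Require Import finmap.
From mathcomp Require Import boolp classical_sets cardinality.

Set Implicit Arguments.
Unset Strict Implicit.
Unset Printing Implicit Defensive.

Local Open Scope classical_set_scope.
Local Open Scope nat_scope.

(** * Multi-tape oracle Turing machines *)

(* Tape symbols are natural numbers and [0] is the blank.  A two-way infinite
   tape is a pair [(l, r)]: [r] lists the cells from the scanned one rightwards,
   [l] the cells to its left, nearest first; cells not listed are blank. *)
Definition tape : Type := (seq nat * seq nat)%type.

Definition scanned (t : tape) : nat := head 0 t.2.

Definition write (b : nat) (t : tape) : tape := (t.1, b :: behead t.2).

Inductive direction := GoLeft | Stay | GoRight.

Definition move (d : direction) (t : tape) : tape :=
  match d with
  | GoLeft => (behead t.1, head 0 t.1 :: t.2)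
  | Stay => t
  | GoRight => (head 0 t.2 :: t.1, behead t.2)
  end.

(* The number on a tape, in unary: the length of the block of non-blank symbols
   that starts at the scanned cell. *)
Definition tape_num (t : tape) : nat := find (pred1 0) t.2.

(* [Act q t a b d q']: in state [q], scanning [a] on tape [t], write [b] on that
   tape, move its head by [d] and go to state [q'].
   [Query q t q1 q0]: in state [q], go to [q1] if the number on tape [t] belongs
   to the oracle and to [q0] otherwise. *)
Inductive instr :=
| Act (q t a b : nat) (d : direction) (q' : nat)
| Query (q t q1 q0 : nat).

(* States are natural numbers, [0] is the initial one.  The first applicable
   instruction is executed; the machine halts when there is none. *)
Record TM := MkTM {
  tm_alph : {fset nat};   (* input alphabet *)
  tm_prog : seq instr }.

Record config := Config {
  state : nat;
  tapes : nat -> tape }.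

Definition applicable (c : config) (i : instr) : bool :=
  match i with
  | Act q t a _ _ _ => (state c == q) && (scanned (tapes c t) == a)
  | Query q _ _ _ => state c == q
  end.

Definition exec (B : set nat) (c : config) (i : instr) : config :=
  match i with
  | Act _ t _ b d q' =>
      Config q' (fun u => if u == t then move d (write b (tapes c t))
                          else tapes c u)
  | Query _ t q1 q0 =>
      Config (if `[< B (tape_num (tapes c t)) >] then q1 else q0) (tapes c)
  end.

Definition step (B : set nat) (M : TM) (c : config) : option config :=
  omap (exec B c) (ohead [seq i <- tm_prog M | applicable c i]).

(* The letter [a] is written on the tape as the non-blank symbol [a.+1]. *)
Definition init (x : seq nat) : config :=
  Config 0 (fun u => if u == 0 then ([::], [seq a.+1 | a <- x]) else ([::], [::])).

Definition halts_in (B : set nat) (M : TM) (x : seq nat) (c : config) : Prop :=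
  exists n, iter n (obind (step B M)) (Some (init x)) = Some c
            /\ step B M c = None.

Definition halts (B : set nat) (M : TM) (x : seq nat) : Prop :=
  exists c, halts_in B M x c.

Definition computes (B : set nat) (M : TM) (x : seq nat) (y : nat) : Prop :=
  exists c, halts_in B M x c /\ tape_num (tapes c 0) = y.

(* Numbers are given to machines in unary, binary strings letter by letter. *)
Definition unary (n : nat) : seq nat := nseq n 0.
Definition bits (D : seq bool) : seq nat := [seq nat_of_bool b | b <- D].

(** * Goedel numbering, Turing reducibility and the jump *)

Definition direction_code (d : direction) : nat :=
  match d with GoLeft => 0 | Stay => 1 | GoRight => 2 end.

Definition instr_code (i : instr) : nat :=
  match i with
  | Act q t a b d q' => CodeSeq.code [:: 0; q; t; a; b; direction_code d; q']
  | Query q t q1 q0 => CodeSeq.code [:: 1; q; t; q1; q0]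
  end.

Definition TM_code (M : TM) : nat :=
  CodeSeq.code (CodeSeq.code (enum_fset (tm_alph M))
                :: [seq instr_code i | i <- tm_prog M]).

(* Computability without an oracle is computability with oracle [set0]. *)
Definition fun_recursive_in (B : set nat) (f : nat -> nat) : Prop :=
  exists M, forall n, computes B M (unary n) (f n).

Definition set_recursive_in (B : set nat) (X : set (seq bool)) : Prop :=
  exists M, forall D, computes B M (bits D) `[< X D >].

Definition jump (B : set nat) : set nat :=
  [set e | exists2 M, e = TM_code M & halts B M (unary e)].

(** * Formal languages *)

Definition word_over (A : {fset nat}) (w : seq nat) : bool :=
  all (fun a => a \in A) w.

(* A formal language comes with the alphabet over which it is a language, so
   equal languages have equal alphabets. *)
Record language := MkLanguage {
  alph : {fset nat};
  words : set (seq nat);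
  words_over : forall w, words w -> word_over alph w }.

Definition decides (M : TM) (L : language) : Prop :=
  tm_alph M = alph L /\
  forall w, word_over (alph L) w -> computes set0 M w `[< words L w >].

Definition semidecides (M : TM) (L : language) : Prop :=
  tm_alph M = alph L /\
  forall w, word_over (alph L) w -> (halts set0 M w <-> words L w).

Definition recursive_language (L : language) : Prop := exists M, decides M L.

Definition re_language (L : language) : Prop := exists M, semidecides M L.

(** * Descriptional systems *)

Definition all_recursive (S : set (seq bool)) (L : seq bool -> language) : Prop :=
  forall D, S D -> recursive_language (L D).

Definition all_re (S : set (seq bool)) (L : seq bool -> language) : Prop :=
  forall D, S D -> re_language (L D).

(* There is an effective procedure, uniform in [D], that converts a descriptor
   [D] into a Turing machine [N] with [P N (L D)]. *)
Definition effective_conversion (P : TM -> language -> Prop)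
    (S : set (seq bool)) (L : seq bool -> language) : Prop :=
  exists C : TM, forall D, S D ->
    exists2 N : TM, computes set0 C (bits D) (TM_code N) & P N (L D).

(* Descriptors are binary strings; only the values of [ds_lang] on [ds_set]
   matter.  Conversion into deciders is required only of systems all of whose
   languages are recursive: no effective procedure turns every Turing machine
   that happens to accept a recursive language into a decider for it. *)
Record desc_system := DescSystem {
  ds_set : set (seq bool);
  ds_lang : seq bool -> language;
  ds_set_recursive : set_recursive_in set0 ds_set;
  ds_nonempty : forall D, ds_set D -> D != [::];
  ds_decider :
    all_recursive ds_set ds_lang -> effective_conversion decides ds_set ds_lang;
  ds_semidecider :
    all_re ds_set ds_lang -> effective_conversion semidecides ds_set ds_lang;
  ds_re : all_re ds_set ds_lang }.

Definition recursive_system (S : desc_system) : Prop :=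
  all_recursive (ds_set S) (ds_lang S).

Definition described_languages (S : desc_system) : set language :=
  ds_lang S @` ds_set S.

Definition descriptors_of (S : desc_system) (L : language) : set (seq bool) :=
  [set D | ds_set S D /\ ds_lang S D = L].

Definition descriptors_over (S : desc_system) (A : {fset nat}) : set (seq bool) :=
  [set D | ds_set S D /\ alph (ds_lang S D) = A].

(* [X] is recursively enumerable in order of increasing [c]: some machine, on
   input [i], outputs the [i]-th term of an enumeration of [X] along which [c]
   is nondecreasing.  The enumeration may be finite, in which case the machine
   halts only on an initial segment of the inputs. *)
Definition re_by_size (c : seq bool -> nat) (X : set (seq bool)) : Prop :=
  exists M : TM,
    let out i D := computes set0 M (unary i) (CodeSeq.code (bits D)) in
    [/\ forall i, halts set0 M (unary i) -> exists2 D, X D & out i D,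
        forall D, X D -> exists i, out i D,
        forall i j, i <= j -> halts set0 M (unary j) -> halts set0 M (unary i)
      & forall i j D E, i <= j -> out i D -> out j E -> c D <= c E].

Definition complexity_measure (S : desc_system) (c : seq bool -> nat) : Prop :=
  [/\ exists M : TM, forall D, ds_set S D -> computes set0 M (bits D) (c D),
      forall A, re_by_size c (descriptors_over S A)
    & forall A n, finite_set [set D | descriptors_over S A D /\ c D = n]].

Definition upper_bound (S1 S2 : desc_system) (c1 c2 : seq bool -> nat)
    (f : nat -> nat) : Prop :=
  (forall n, n <= f n) /\
  forall D1, ds_set S1 D1 -> described_languages S2 (ds_lang S1 D1) ->
    exists2 D2, descriptors_of S2 (ds_lang S1 D1) D2 & c2 D2 <= f (c1 D1).

(* The yes-instances of the [S2]-ness problem for [S1] descriptors. *)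
Definition ness (S2 S1 : desc_system) : set (seq bool) :=
  [set D1 | ds_set S1 D1 /\ described_languages S2 (ds_lang S1 D1)].

(* Main.v *)
(* The alphabet of a language can be computed from any descriptor of it, so that
   "[D2] is over the alphabet of [D1] and [c2 D2 <= n]" is a recursively
   enumerable relation, satisfied by finitely many [D2] for each [D1] and [n].
   Taking [n = f (c1 D1)], the oracle finds a bound [k] beyond which there are no
   such [D2], and [D1] is a yes-instance if and only if one of the finitely many
   candidates below [k] describes the same language.  That two languages differ
   is r.e. if both come with deciders, and r.e. in the first jump if they come
   with semi-deciders; hence its negation is decided by the oracle.  So both
   the yes-instances and the no-instances are r.e. in the oracle.

   Machines are handled through functions primitive recursive in an oracle on
   codes of sequences: these are compiled to machines one of whose tapes holds
   each register in unary, and conversely one step of a machine is such a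
   function of the code of the machine and of its configuration. *)

Require Import Defs.
From mathcomp Require Import all_boot.
From mathcomp Require Import finmap.
From mathcomp Require Import boolp classical_sets cardinality.
From mathcomp Require Import zify.

Set Implicit Arguments.
Unset Strict Implicit.
Unset Printing Implicit Defensive.

Local Open Scope classical_set_scope.

(** Both cases are one statement about [jump B], where [B] is an oracle in which acceptance and
    rejection by the converted machines are both enumerable: the empty set for deciders, the first
    jump for semi-deciders, whose rejection is non-halting. That asymmetry is the whole cost of the
    extra jump. The value [n = f (c1 D1)] must never occur under a negation: its graph is only
    enumerable in [jump B], and negating it would cost one more jump. It is therefore an existential
    witness, and the predicates that do get negated take [n] as an argument and are enumerable in
    [B]. Only one kind of machine is ever programmed, an unbounded search around a primitive
    recursive test. The machines given with the systems, the measures and [f] are never composed as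
    programs. They are interpreted, so that a fact about them becomes an existential quantifier over
    a primitive recursive test, and combining such facts is mere logic. *)

(** * Program fragments on disjoint ranges of states, acting on unary registers *)

Definition instr_state (i : instr) : nat :=
  match i with Act q _ _ _ _ _ => q | Query q _ _ _ => q end.

(** Execution depends on the program alone, so the alphabet is filled in with [fset0]. *)
Definition reaches (B : set nat) (p : seq instr) (n : nat) (c c' : config) : Prop :=
  iter n (obind (step B (MkTM fset0 p))) (Some c) = Some c'.

Lemma applicable_state c i : applicable c i -> instr_state i = state c.
Proof. by case: i => [q t a b d q'|q t q1 q0] /= => [/andP[/eqP]|/eqP]. Qed.

Lemma reaches1 B p c c' :
  step B (MkTM fset0 p) c = Some c' -> reaches B p 1 c c'.
Proof. by []. Qed.

Lemma reaches_trans B p n1 n2 c1 c2 c3 :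
  reaches B p n1 c1 c2 -> reaches B p n2 c2 c3 -> reaches B p (n1 + n2) c1 c3.
Proof. by rewrite /reaches addnC iterD => ->. Qed.

Lemma reachesSr B p n c c' : reaches B p n.+1 c c' ->
  exists2 c1, reaches B p n c c1 & step B (MkTM fset0 p) c1 = Some c'.
Proof.
rewrite /reaches iterS; case E: (iter n _ _) => [c1|] //= st.
by exists c1.
Qed.

Definition states_in (a b : nat) : pred (seq instr) :=
  all (fun i => a <= instr_state i < b).

Definition states_out (a b : nat) : pred (seq instr) :=
  all (fun i => ~~ (a <= instr_state i < b)).

Lemma states_in_sub a b a' b' p :
  a' <= a -> b <= b' -> states_in a b p -> states_in a' b' p.
Proof. by move=> la lb; apply: sub_all => i; lia. Qed.

Lemma states_in_out a b a' b' p :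
  (b <= a') || (b' <= a) -> states_in a b p -> states_out a' b' p.
Proof. by move=> l; apply: sub_all => i; lia. Qed.

Lemma step_state B a b p c c' :
  states_in a b p -> step B (MkTM fset0 p) c = Some c' -> a <= state c < b.
Proof.
elim: p => //= i p IH /andP[ai inp]; rewrite /step /=.
by case: ifP => [/applicable_state <- //|_ st]; apply: IH.
Qed.

Lemma applicable_out a b p c :
  states_out a b p -> a <= state c < b -> [seq i <- p | applicable c i] = [::].
Proof.
move=> outp sc; elim: p outp => //= i p IH /andP[oi /IH ->].
by case: ifP => // /applicable_state si; rewrite si sc in oi.
Qed.

(** The first applicable instruction wins, so it is the instructions before [p] that have to keep
    off its states. *)
Lemma step_cat B a b p1 p p2 c c' :
  states_in a b p -> states_out a b p1 ->
  step B (MkTM fset0 p) c = Some c' ->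
  step B (MkTM fset0 (p1 ++ p ++ p2)) c = Some c'.
Proof.
move=> inp outp1 st; have sc := step_state inp st.
move: st; rewrite /step /= !filter_cat (applicable_out outp1 sc) /=.
by case: [seq i <- p | applicable c i].
Qed.

Lemma reaches_cat B a b p1 p p2 n c c' :
  states_in a b p -> states_out a b p1 ->
  reaches B p n c c' -> reaches B (p1 ++ p ++ p2) n c c'.
Proof.
move=> inp outp1; elim: n c' => [c'|n IH c'].
  by rewrite /reaches.
move=> /reachesSr[c1 /IH r1 st].
by rewrite /reaches iterS r1 /=; exact: step_cat inp outp1 st.
Qed.

(** Stated through [nth] because moves leave explicit blanks in the lists, which must count like
    unlisted cells. The left half has to be blank because the block of ones grows to the left. *)
Definition num_tape (n : nat) (t : tape) : Prop :=
  (forall i, nth 0 t.1 i = 0) /\ (forall i, nth 0 t.2 i = (i < n)).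

Lemma num_tape_num n t : num_tape n t -> tape_num t = n.
Proof.
move=> [_ H]; rewrite /tape_num.
have sz : n <= size t.2.
  by case: leqP => // lt; have := H (size t.2); rewrite nth_default // lt.
apply/eqP; rewrite eqn_leq; apply/andP; split; last first.
  rewrite leqNgt; apply/negP => lt.
  have hs : has (pred1 0) t.2 by rewrite has_find; exact: leq_trans sz.
  by have := nth_find 0 hs; rewrite /= H lt.
rewrite leqNgt; apply/negP => /(before_find 0) /=.
by rewrite H ltnn.
Qed.

Lemma num_tape_scanned n t : num_tape n t -> scanned t = (0 < n).
Proof. by move=> [_ H]; rewrite /scanned -nth0 H. Qed.

(* From [z] on, tape [r] carries the content [m r] of the [r]-th register; the
   tapes below [z] may hold anything, such as an input yet to be read. *)
Definition represents (z : nat) (m : nat -> nat) (T : nat -> tape) : Prop :=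
  forall r, z <= r -> num_tape (m r) (T r).

Definition upd (m : nat -> nat) (r v : nat) : nat -> nat :=
  fun i => if i == r then v else m i.

Definition relation := (nat -> nat) -> (nat -> nat) -> Prop.

(* The fragment may be placed at any state [a], and is left at state [b]. *)
Definition realizable (B : set nat) (z : nat) (R : relation) : Prop :=
  forall a, exists p b, [/\ a <= b, states_in a b p &
    forall m T, represents z m T -> exists m' T' n,
      [/\ R m m', represents z m' T', forall r, r < z -> T' r = T r &
          reaches B p n (Config a T) (Config b T')]].

Section Fragments.
Variables (B : set nat) (z : nat).

Lemma realizable_sub (R R' : relation) :
  (forall m m', R m m' -> R' m m') -> realizable B z R -> realizable B z R'.
Proof.
move=> sub H a; have [p [b [ab inp run]]] := H a; exists p, b; split=> // m T rT.
have [m' [T' [n [/sub ? ? ? ?]]]] := run m T rT.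
by exists m', T', n.
Qed.

Lemma realizable_seq (R1 R2 : relation) :
  realizable B z R1 -> realizable B z R2 ->
  realizable B z (fun m m' => exists2 m1, R1 m m1 & R2 m1 m').
Proof.
move=> H1 H2 a; have [p1 [b [ab in1 run1]]] := H1 a.
have [p2 [c [bc in2 run2]]] := H2 b; exists (p1 ++ p2), c.
split; first exact: leq_trans bc.
  rewrite /states_in all_cat; apply/andP; split.
    exact: states_in_sub in1.
  exact: states_in_sub in2.
move=> m T /run1[m1 [T1 [n1 [R1m rT1 z1 re1]]]].
have [m2 [T2 [n2 [R2m rT2 z2 re2]]]] := run2 _ _ rT1.
exists m2, T2, (n1 + n2); split=> //.
- by exists m1.
- by move=> r rz; rewrite z2 // z1.
apply: (reaches_trans (c2 := Config b T1)).
  exact: (reaches_cat (p1 := [::]) p2 in1 _ re1).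
have := reaches_cat (p1 := p1) [::] in2 _ re2; rewrite cats0; apply.
by apply: states_in_out in1; rewrite leqnn.
Qed.

(** Growing to the left leaves the head on the first cell of the block. An action always writes,
    hence the scanned symbol is first written back. *)
Lemma num_tape_succ n t :
  num_tape n t ->
  num_tape n.+1 (write 1 (move GoLeft (write (scanned t) t))).
Proof.
move=> [hl hr]; split=> [i|[|i]] //=; first by rewrite nth_behead.
by case: i => [|i] /=; rewrite /scanned -?nth0 ?nth_behead hr.
Qed.

Lemma num_tape_pred n t :
  num_tape n.+1 t -> num_tape n (move GoRight (write 0 t)).
Proof.
move=> [hl hr]; split=> [[|i]|i] //=; last by rewrite nth_behead hr.
Qed.

Lemma represents_upd m T r v t :
  represents z m T -> num_tape v t ->
  represents z (upd m r v) (fun u => if u == r then t else T u).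
Proof. by move=> rT tv u zu; rewrite /upd; case: eqP => // _; apply: rT. Qed.

Lemma step_cons i p c :
  step B (MkTM fset0 (i :: p)) c =
  if applicable c i then Some (exec B c i) else step B (MkTM fset0 p) c.
Proof. by rewrite /step /=; case: ifP. Qed.

Lemma realizable_inc r : z <= r ->
  realizable B z (fun m m' => m' = upd m r (m r).+1).
Proof.
move=> zr a.
exists [:: Act a r 0 0 GoLeft a.+1; Act a r 1 1 GoLeft a.+1; Act a.+1 r 0 1 Stay a.+2], a.+2.
split; [lia | by rewrite /states_in /=; lia |].
move=> m T rT; have nr := rT r zr; have sc := num_tape_scanned nr.
exists (upd m r (m r).+1).
pose T1 u := if u == r then move GoLeft (write (scanned (T r)) (T r)) else T u.
exists (fun u => if u == r then write 1 (T1 r) else T1 u), 2; split=> //.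
- move=> u zu; rewrite /T1 eqxx; have := represents_upd r rT (num_tape_succ nr) zu.
  by case: eqP.
- by move=> u uz; rewrite /T1; case: eqP => // ur; move: uz; rewrite ur ltnNge zr.
apply: (@reaches_trans _ _ 1 1 _ (Config a.+1 T1)); apply: reaches1.
  rewrite !step_cons /= !eqxx sc /T1 sc.
  by case: (0 < m r).
rewrite !step_cons /= (gtn_eqF (ltnSn a)) !eqxx /T1 eqxx /=.
by have [hl _] := nr; rewrite /scanned /= -nth0 hl.
Qed.

Lemma realizable_dec r : z <= r ->
  realizable B z (fun m m' => m' = upd m r (m r).-1).
Proof.
move=> zr a.
exists [:: Act a r 0 0 Stay a.+1; Act a r 1 0 GoRight a.+1], a.+1.
split; [lia | by rewrite /states_in /=; lia |].
move=> m T rT; have nr := rT r zr; have sc := num_tape_scanned nr.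
exists (upd m r (m r).-1).
case mr: (m r) => [|n] in nr sc *.
  exists (fun u => if u == r then move Stay (write 0 (T r)) else T u), 1.
  split=> //.
  - apply: represents_upd => //; have [hl hr] := nr; split=> // [[|i]] //=.
    by rewrite nth_behead hr.
  - by move=> u uz; case: eqP => // ur; move: uz; rewrite ur ltnNge zr.
  by apply: reaches1; rewrite step_cons /= eqxx sc.
exists (fun u => if u == r then move GoRight (write 0 (T r)) else T u), 1.
split=> //.
- exact: represents_upd (num_tape_pred nr).
- by move=> u uz; case: eqP => // ur; move: uz; rewrite ur ltnNge zr.
by apply: reaches1; rewrite !step_cons /= eqxx sc.
Qed.

(* A query whose two outcomes agree is an unconditional jump. *)
Lemma step_jump a r b T p :
  step B (MkTM fset0 (Query a r b b :: p)) (Config a T) = Some (Config b T).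
Proof. by rewrite step_cons /= eqxx if_same. Qed.

(** [I] is an invariant relating the memory at entry to the memory at each test; the tested register
    itself is the variant that ensures termination. *)
Lemma realizable_while (I : relation) (R : relation) r :
  z <= r -> realizable B z R -> (forall m, I m m) ->
  (forall m0 m m', I m0 m -> 0 < m r -> R m m' -> I m0 m' /\ m' r < m r) ->
  realizable B z (fun m m' => I m m' /\ m' r = 0).
Proof.
move=> zr HR I0 IS a; have [p [b [ab inp run]]] := HR a.+2.
(* The query shares its state with the exit instruction but comes after it, so it fires only when
   the register is not zero. *)
set test := [:: Act a r 0 0 Stay b.+1; Query a r a.+2 a.+2].
set back := [:: Query b r a a].
exists (test ++ p ++ back), b.+1; split; first by lia.
  rewrite /states_in !all_cat -/(states_in _ _ p) (states_in_sub _ _ inp) /=; lia.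
have outp : states_out a.+2 b test by rewrite /states_out /=; lia.
(* The induction lets the current memory [m] vary while the invariant keeps referring to the memory
   [m0] at entry. *)
move=> m0 T; have := I0 m0; move: {2 3}m0 => m.
have [k] := ubnP (m r); elim: k m T => // k IH m T mk Im rT.
have sc := num_tape_scanned (rT r zr).
case: (posnP (m r)) => [mr0|mr].
  exists m, (fun u => if u == r then write 0 (T r) else T u), 1; split=> //.
  - move=> u zu; case: eqP => [->|_]; last exact: rT.
    have [hl hr] := rT r zr; split=> // [[|i]] /=; first by rewrite mr0.
    by rewrite nth_behead hr.
  - by move=> u uz; case: eqP => // ur; move: uz; rewrite ur ltnNge zr.
  by apply: reaches1; rewrite /= step_cons /= eqxx sc mr0.
have [m1 [T1 [n1 [R1 rT1 z1 re1]]]] := run m T rT.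
have [I1 lt1] := IS m0 m m1 Im mr R1.
have [|//|//|m' [T' [n [Im' rT' z' re']]]] := IH m1 T1; first by lia.
exists m', T', (1 + (n1 + (1 + n))); split=> //.
  by move=> u uz; rewrite z' // z1.
apply: (@reaches_trans _ _ _ _ _ (Config a.+2 T)).
  by apply: reaches1; rewrite /= !step_cons /= !eqxx sc mr if_same.
apply: (@reaches_trans _ _ _ _ _ (Config b T1)).
  exact: reaches_cat inp outp re1.
apply: (@reaches_trans _ _ _ _ _ (Config a T1)) => //.
have := @step_cat B b b.+1 (test ++ p) back [::] (Config b T1) (Config a T1).
rewrite cats0 -catA => H; apply/reaches1/H; last exact: step_jump.
  by rewrite /states_in /=; lia.
rewrite /states_out all_cat -/(states_out b b.+1 p).
by rewrite (states_in_out _ inp) ?leqnn //= /states_out; lia.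
Qed.

Lemma realizable_query (R1 R0 : relation) r :
  z <= r -> realizable B z R1 -> realizable B z R0 ->
  realizable B z (fun m m' => if `[< B (m r) >] then R1 m m' else R0 m m').
Proof.
move=> zr H1 H0 a; have [p1 [b1 [ab1 in1 run1]]] := H1 a.+1.
have [p0 [b0 [ab0 in0 run0]]] := H0 b1.+1.
set test := [:: Query a r a.+1 b1.+1].
set jmp := [:: Query b1 r b0 b0].
exists (test ++ p1 ++ jmp ++ p0), b0; split; first by lia.
  rewrite /states_in !all_cat -/(states_in a b0 p1) -/(states_in a b0 p0).
  by rewrite (states_in_sub _ _ in1) ?(states_in_sub _ _ in0) /=; lia.
have out1 : states_out a.+1 b1 test by rewrite /states_out /=; lia.
have outj : states_out b1 b1.+1 (test ++ p1).
  rewrite /states_out all_cat -/(states_out b1 b1.+1 p1).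
  by rewrite (states_in_out _ in1) ?leqnn //=; lia.
have out0 : states_out b1.+1 b0 (test ++ p1 ++ jmp).
  rewrite /states_out !all_cat -/(states_out b1.+1 b0 p1).
  by rewrite (states_in_out _ in1) ?leqnSn //=; lia.
move=> m T rT.
have st : step B (MkTM fset0 (test ++ p1 ++ jmp ++ p0)) (Config a T) =
    Some (Config (if `[< B (m r) >] then a.+1 else b1.+1) T).
  by rewrite /= step_cons /= eqxx (num_tape_num (rT r zr)).
case: ifP st => Bm st.
  have [m' [T' [n [Rm rT' z' re]]]] := run1 m T rT.
  exists m', T', (1 + (n + 1)); split=> //.
  apply: (reaches_trans (reaches1 st)).
  apply: (@reaches_trans _ _ _ _ _ (Config b1 T')).
    exact: reaches_cat in1 out1 re.
  have := @step_cat B b1 b1.+1 (test ++ p1) jmp p0 (Config b1 T') (Config b0 T').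
  rewrite -catA => H; apply/reaches1/H => //; last exact: step_jump.
  by rewrite /states_in /=; lia.
have [m' [T' [n [Rm rT' z' re]]]] := run0 m T rT.
exists m', T', (1 + n); split=> //.
apply: (reaches_trans (reaches1 st)).
by have := reaches_cat [::] in0 out0 re; rewrite cats0 -!catA.
Qed.

End Fragments.

(** * Primitive recursion relative to an oracle *)

(* The argument [s] of [f] is an environment: an infinite list of arguments,
   all but finitely many of them [0]. *)
Inductive primrec (B : set nat) : (seq nat -> nat) -> Prop :=
| primrec_nth i : primrec B (fun s => nth 0 s i)
| primrec0 : primrec B (fun=> 0)
| primrecS f : primrec B f -> primrec B (fun s => (f s).+1)
| primrec_pred f : primrec B f -> primrec B (fun s => (f s).-1)
| primrec_let f g : primrec B f -> primrec B g ->
    primrec B (fun s => f (g s :: s))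
| primrec_omit j f : primrec B f ->
    primrec B (fun s => f (take j s ++ drop j.+1 s))
| primrec_iter f g h : primrec B f -> primrec B g -> primrec B h ->
    primrec B (fun s => iter (h s) (fun x => g (x :: s)) (f s))
| primrec_oracle f : primrec B f ->
    primrec B (fun s => nat_of_bool `[< B (f s) >]).

(** * Compiling primitive recursive functions to register programs *)

Section Compilation.
Variables (B : set nat) (z : nat).
Implicit Types (m : nat -> nat) (r t k : nat).

Lemma realizable_zero r : z <= r -> realizable B z (fun m m' => m' = upd m r 0).
Proof.
move=> zr; pose I : relation := fun m0 m => forall u, u != r -> m u = m0 u.
apply: (@realizable_sub _ _ (fun m m' => I m m' /\ m' r = 0)).
  move=> m m' [Im mr]; apply/funext => u; rewrite /upd.
  by case: (eqVneq u r) => [->|/Im].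
apply: realizable_while zr (realizable_dec B zr) _ _ => // m0 m _ Im mr ->.
split; last by rewrite /upd eqxx; lia.
by move=> u ur; rewrite /upd (negPf ur) Im.
Qed.

Lemma realizable_move r t : z <= r -> z <= t -> r != t ->
  realizable B z (fun m m' => m' = upd (upd m t (m r)) r 0).
Proof.
move=> zr zt rt; have tr : t == r = false by rewrite eq_sym (negPf rt).
pose I : relation := fun m0 m =>
  m t + m r = m0 t + m0 r /\ forall u, u != r -> u != t -> m u = m0 u.
have H := realizable_seq (realizable_dec B zr) (realizable_inc B zt).
have {}H : realizable B z (fun m m' => I m m' /\ m' r = 0).
  apply: realizable_while zr H _ _ => // m0 m m' [Im1 Im2] mr [_ -> ->].
  rewrite /I /upd !eqxx tr eq_sym tr /=; split; last by lia.
  by split; [lia | move=> u ur ut; rewrite (negPf ur) (negPf ut) Im2].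
apply: realizable_sub (realizable_seq (realizable_zero zt) H).
move=> m m' [_ -> [[I1 I2] m'r]]; apply/funext => u.
rewrite /upd !eqxx (negPf rt) in I1 I2 *; case: eqP => [->//|/eqP ur].
case: eqP => [->|/eqP ut]; first by lia.
by rewrite I2 // (negPf ut).
Qed.

(** A loop destroys the register that it tests: [r] is drained into both [t] and the scratch
    register [k], then restored from [k]. *)
Lemma realizable_copy r t k : z <= r -> z <= t -> z <= k ->
  [&& r != t, r != k & t != k] ->
  realizable B z (fun m m' => m' = upd (upd m t (m r)) k 0).
Proof.
move=> zr zt zk /and3P[rt rk tk].
have nr : (r == t = false) * (t == r = false) * (r == k = false) *
    (k == r = false) * (t == k = false) * (k == t = false).
  by do !split; apply/eqP/eqP; rewrite // eq_sym.
pose I : relation := fun m0 m =>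
  [/\ m t + m r = m0 t + m0 r, m k + m r = m0 k + m0 r &
      forall u, u != r -> u != t -> u != k -> m u = m0 u].
have H := realizable_seq (realizable_dec B zr)
  (realizable_seq (realizable_inc B zt) (realizable_inc B zk)).
have {}H : realizable B z (fun m m' => I m m' /\ m' r = 0).
  apply: realizable_while zr H _ _ => // m0 m m' [I1 I2 I3] mr [_ -> [_ -> ->]].
  rewrite /I /upd !eqxx !nr /=; split; last by lia.
  split; [lia | lia |].
  by move=> u ur ut uk; rewrite (negPf ur) (negPf ut) (negPf uk) I3.
have Hz := realizable_seq (realizable_zero zt) (realizable_zero zk).
have kr : k != r by rewrite nr.
have Hm := realizable_move zk zr kr.
apply: realizable_sub (realizable_seq (realizable_seq Hz H) Hm).
move=> m m' [m1 [_ [_ -> ->] [[I1 I2 I3] m1r]] ->]; apply/funext => u.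
rewrite /upd !eqxx !nr in I1 I2 I3 *.
case: (eqVneq u k) => // uk; case: (eqVneq u r) => [->|ur].
  by rewrite nr; lia.
case: (eqVneq u t) => [->|ut]; first by lia.
by rewrite I3 // (negPf ut) (negPf uk).
Qed.

(* Registers from [k] on are scratch. *)
Definition assigns k t (v : (nat -> nat) -> nat) : relation :=
  fun m m' => m' t = v m /\ forall u, u < k -> u != t -> m' u = m u.

(** The environment is a list [rho] of registers: a [let] takes one fresh register and an omission
    shortens [rho], without copying arguments. As [t] is not in [rho], the arguments survive the
    evaluation. *)
Definition evaluable (f : seq nat -> nat) : Prop :=
  forall rho t k, all (fun r => z <= r < k) rho -> z <= t < k -> t \notin rho ->
  realizable B z (assigns k t (fun m => f [seq m r | r <- rho])).

Lemma map_agree k t rho m m' :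
  all (fun r => z <= r < k) rho -> t \notin rho ->
  (forall u, u < k -> u != t -> m' u = m u) ->
  [seq m' r | r <- rho] = [seq m r | r <- rho].
Proof.
move=> /allP rk trho H; apply/eq_in_map => r rrho; apply: H.
  by have /andP[] := rk _ rrho.
by apply: contraNneq trho => <-.
Qed.

Lemma all_below k k' rho : k <= k' ->
  all (fun r => z <= r < k) rho -> all (fun r => z <= r < k') rho.
Proof. by move=> kk; apply: sub_all => r; lia. Qed.

Lemma notin_below k rho : all (fun r => z <= r < k) rho -> k \notin rho.
Proof. by move=> /allP H; apply/negP => /H; lia. Qed.

Lemma evaluable_nth i : evaluable (fun s => nth 0 s i).
Proof.
move=> rho t k rk /andP[zt tk] trho; have zk := leq_trans zt (ltnW tk).
case: (ltnP i (size rho)) => isz; last first.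
  apply: realizable_sub (realizable_zero zt) => m m' ->; rewrite /assigns /upd.
  rewrite eqxx nth_default ?size_map //; split=> // u _ /negPf -> //.
have /allP/(_ _ (mem_nth 0 isz)) /andP[zr rk'] := rk.
have rt : nth 0 rho i != t.
  by apply: contraNneq trho => <-; apply: mem_nth.
have ne : [&& nth 0 rho i != t, nth 0 rho i != k & t != k].
  by rewrite rt !ltn_eqF.
apply: realizable_sub (realizable_copy zr zt zk ne).
move=> m m' ->; rewrite /assigns /upd eqxx (ltn_eqF tk) (nth_map 0) //.
by split=> // u uk /negPf ->; rewrite (ltn_eqF uk).
Qed.

Lemma evaluable_let f g :
  evaluable f -> evaluable g -> evaluable (fun s => f (g s :: s)).
Proof.
move=> Hf Hg rho t k rk /andP[zt tk] trho; have zk := leq_trans zt (ltnW tk).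
have kr := notin_below rk.
have rk1 := all_below (leqnSn k) rk.
have zkk : z <= k < k.+1 by lia.
have ztk : z <= t < k.+1 by lia.
have rk1' : all (fun r => z <= r < k.+1) (k :: rho) by rewrite /= rk1 zkk.
have tkr : t \notin k :: rho by rewrite inE negb_or trho ltn_eqF.
have {}Hg := Hg rho k k.+1 rk1 zkk kr.
have {}Hf := Hf (k :: rho) t k.+1 rk1' ztk tkr.
apply: realizable_sub (realizable_seq Hg Hf) => m m' [m1 [e1 H1] [e2 H2]].
split; first by rewrite e2 /= e1 (map_agree rk1 kr H1).
by move=> u uk ut; rewrite H2 ?H1 //; lia.
Qed.

(** Register [k] counts the remaining rounds and [k.+1] is the accumulator. Its next value is
    computed in [k.+2], since the target of [g] may not be among its arguments. *)
Lemma evaluable_iter f g h : evaluable f -> evaluable g -> evaluable h ->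
  evaluable (fun s => iter (h s) (fun x => g (x :: s)) (f s)).
Proof.
move=> Hf Hg Hh rho t k rk /andP[zt tk] trho; have zk := leq_trans zt (ltnW tk).
have zk1 := leqW zk; have zk2 := leqW zk1.
have zkk : z <= k < k.+1 by rewrite zk leqnn.
have zkk1 : z <= k.+1 < k.+2 by rewrite zk1 leqnn.
have zkk2 : z <= k.+2 < k.+3 by rewrite zk2 leqnn.
have ne1t : k.+1 != t by rewrite gtn_eqF // leqW.
have ne21 : k.+2 != k.+1 by rewrite gtn_eqF.
have low u : u < k -> ((u == k) = false) * ((u == k.+1) = false) *
    ((u == k.+2) = false) * (u < k.+1) * (u < k.+2) * (u < k.+3).
  by move=> uk; do !split; try apply: ltn_eqF; do 3?[exact: uk | apply: leqW].
have k_k1 : (k == k.+1) = false by rewrite ltn_eqF.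
have k_k2 : (k == k.+2) = false by rewrite ltn_eqF.
have k1_k : (k.+1 == k) = false by rewrite gtn_eqF.
have k1_k2 : (k.+1 == k.+2) = false by rewrite ltn_eqF.
have rk1 : all (fun r => z <= r < k.+1) rho := all_below (leqnSn k) rk.
have rk2 : all (fun r => z <= r < k.+2) rho := all_below (leqnSn _) rk1.
have rk3 : all (fun r => z <= r < k.+3) rho := all_below (leqnSn _) rk2.
have k1 := notin_below rk1; have k2 := notin_below rk2.
have rk3' : all (fun r => z <= r < k.+3) (k.+1 :: rho).
  by rewrite /= rk3 zk1 leqnSn.
have k2' : k.+2 \notin k.+1 :: rho by rewrite inE negb_or k2 gtn_eqF.
have {}Hh := Hh rho k k.+1 rk1 zkk (notin_below rk).
have {}Hf := Hf rho k.+1 k.+2 rk2 zkk1 k1.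
have {}Hg := Hg (k.+1 :: rho) k.+2 k.+3 rk3' zkk2 k2'.
have Hb := realizable_seq (realizable_dec B zk)
  (realizable_seq Hg (realizable_move zk2 zk1 ne21)).
pose G m x := g (x :: [seq m r | r <- rho]).
(* The invariant is the final result: running the remaining [m k] rounds from the current
   accumulator always gives the same value. *)
pose I : relation := fun m0 m => (forall u, u < k -> m u = m0 u) /\
  iter (m k) (G m0) (m k.+1) = iter (m0 k) (G m0) (m0 k.+1).
have {}Hb : realizable B z (fun m m' => I m m' /\ m' k = 0).
  apply: realizable_while zk Hb _ _ => // m0 m m' [I1 I2] mk [_ -> [m2 [e2 H2] ->]].
  have km u : u < k -> m2 u = m u.
    by move=> /low uk; rewrite H2 ?/upd ?uk.
  have m2k : m2 k = (m k).-1.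
    by rewrite H2 /upd ?eqxx ?k_k2 // leqW.
  have Em : [seq upd m k (m k).-1 r | r <- rho] = [seq m0 r | r <- rho].
    apply/eq_in_map => r /(allP rk) /andP[_ rk']; rewrite /upd (low _ rk').
    exact: I1.
  split; last by rewrite /upd k_k2 k_k1 m2k ltn_predL.
  split.
    by move=> u uk; rewrite /upd !(low _ uk) km ?I1.
  rewrite -I2 /upd k_k2 k_k1 m2k k1_k2 eqxx.
  rewrite e2 /= Em -/(G m0 _) -iterSr prednK //.
  by rewrite /upd k1_k.
apply: realizable_sub (realizable_seq (realizable_seq Hh Hf)
  (realizable_seq Hb (realizable_move zk1 zt ne1t))).
move=> m m' [m2 [m1 [e1 H1] [e2 H2]] [m3 [[I1 I2] m3k] ->]].
have E1 := map_agree rk1 (notin_below rk) H1.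
have E2 := map_agree rk2 k1 H2.
split.
  rewrite /upd eqxx low //.
  move: I2; rewrite m3k /= => ->; rewrite e2 H2 ?k_k1 // e1.
  by rewrite /G E2 E1.
move=> u uk ut; rewrite /upd (negPf ut) !(low _ uk).
by rewrite I1 // H2 ?H1 ?(low _ uk).
Qed.

Lemma primrec_evaluable f : primrec B f -> evaluable f.
Proof.
elim=> {f}.
- exact: evaluable_nth.
- move=> rho t k _ /andP[zt _] _; apply: realizable_sub (realizable_zero zt).
  by move=> m m' ->; rewrite /assigns /upd eqxx; split=> // u _ /negPf ->.
- move=> f _ Hf rho t k rk ztk trho; have /andP[zt tk] := ztk.
  apply: realizable_sub
    (realizable_seq (Hf _ _ _ rk ztk trho) (realizable_inc B zt)).
  move=> m m' [m1 [e1 H1] ->]; rewrite /assigns /upd eqxx e1; split=> // u uk ut.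
  by rewrite (negPf ut) H1.
- move=> f _ Hf rho t k rk ztk trho; have /andP[zt tk] := ztk.
  apply: realizable_sub
    (realizable_seq (Hf _ _ _ rk ztk trho) (realizable_dec B zt)).
  move=> m m' [m1 [e1 H1] ->]; rewrite /assigns /upd eqxx e1; split=> // u uk ut.
  by rewrite (negPf ut) H1.
- by move=> f g _ Hf _ Hg; apply: evaluable_let.
- move=> j f _ Hf rho t k /allP rk ztk trho.
  have sub : {subset take j rho ++ drop j.+1 rho <= rho}.
    by move=> r; rewrite mem_cat => /orP[/mem_take|/mem_drop].
  have := Hf (take j rho ++ drop j.+1 rho) t k _ ztk _.
  rewrite [X in assigns _ _ X](_ : _ = fun m : nat -> nat =>
      f (take j [seq m r | r <- rho] ++ drop j.+1 [seq m r | r <- rho])).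
    apply; first by apply/allP => r /sub/rk.
    by apply: contra trho => /sub.
  by apply/funext => m; rewrite map_cat map_take map_drop.
- by move=> f g h _ Hf _ Hg _ Hh; apply: evaluable_iter.
move=> f _ Hf rho t k rk ztk trho; have /andP[zt tk] := ztk.
have H1 := realizable_seq (realizable_zero zt) (realizable_inc B zt).
apply: realizable_sub (realizable_seq (Hf _ _ _ rk ztk trho)
  (realizable_query zt H1 (realizable_zero zt))).
move=> m m' [m1 [e1 H] Hif]; rewrite /assigns -e1.
case: ifP Hif => _ => [[_ -> ->]|->]; rewrite /upd !eqxx; split=> // u uk ut;
  by rewrite (negPf ut) H.
Qed.

End Compilation.

(** * Closure properties of primitive recursive functions *)

Lemma eq_primrec B f g : f =1 g -> primrec B f -> primrec B g.
Proof. by move=> /funext ->. Qed.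

Section PrimrecClosure.
Variable B : set nat.
Implicit Types (e : seq nat -> nat) (b : seq nat -> bool).

Lemma primrec_weak f : primrec B f -> primrec B (fun s => f (behead s)).
Proof.
by move/(primrec_omit 0); apply: eq_primrec => s; rewrite take0 drop1.
Qed.

Lemma primrec_let_behead f e : primrec B f -> primrec B e ->
  primrec B (fun s => f (e s :: behead s)).
Proof.
move=> /(primrec_omit 1) Hf He; apply: eq_primrec (primrec_let Hf He) => s.
by rewrite /= take0 drop1.
Qed.

Lemma primrec_comp1 F e :
  primrec B (fun s => F (nth 0 s 0)) -> primrec B e ->
  primrec B (fun s => F (e s)).
Proof. exact: primrec_let. Qed.

(** Reduces the closure lemmas below to arguments that are projections. [e1] is weakened because it
    is evaluated after the value of [e2] has been pushed on the environment. *)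
Lemma primrec_comp2 F e1 e2 :
  primrec B (fun s => F (nth 0 s 0) (nth 0 s 1)) ->
  primrec B e1 -> primrec B e2 -> primrec B (fun s => F (e1 s) (e2 s)).
Proof.
by move=> HF /primrec_weak H1 H2; apply: primrec_let (primrec_let HF H1) H2.
Qed.

Lemma primrec_comp3 F e1 e2 e3 :
  primrec B (fun s => F (nth 0 s 0) (nth 0 s 1) (nth 0 s 2)) ->
  primrec B e1 -> primrec B e2 -> primrec B e3 ->
  primrec B (fun s => F (e1 s) (e2 s) (e3 s)).
Proof.
move=> HF /primrec_weak/primrec_weak H1 /primrec_weak H2 H3.
exact: primrec_let (primrec_let (primrec_let HF H1) H2) H3.
Qed.

Lemma primrec_nth_behead i : primrec B (fun s => nth 0 (behead s) i).
Proof. exact: primrec_weak (primrec_nth B i). Qed.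

Lemma primrec_const n : primrec B (fun=> n).
Proof. by elim: n => [|n IH]; [apply: primrec0 | apply: primrecS IH]. Qed.

Lemma primrec_iterate (G : nat -> seq nat -> nat) e1 e2 :
  primrec B (fun s => G (nth 0 s 0) (behead s)) ->
  primrec B e1 -> primrec B e2 ->
  primrec B (fun s => iter (e1 s) (fun y => G y s) (e2 s)).
Proof. by move=> HG H1 H2; apply: primrec_iter HG H1. Qed.

Lemma primrec_if b e1 e2 : primrec B (fun s => nat_of_bool (b s)) ->
  primrec B e1 -> primrec B e2 ->
  primrec B (fun s => if b s then e1 s else e2 s).
Proof.
move=> Hb /primrec_weak H1 H2; apply: eq_primrec (primrec_iter H2 H1 Hb) => s.
by case: (b s).
Qed.

Lemma primrec_negb b : primrec B (fun s => nat_of_bool (b s)) ->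
  primrec B (fun s => nat_of_bool (~~ b s)).
Proof.
move=> Hb; apply: eq_primrec (primrec_if Hb (primrec_const 0) (primrec_const 1)).
by move=> s; case: (b s).
Qed.

Lemma primrec_andb b1 b2 : primrec B (fun s => nat_of_bool (b1 s)) ->
  primrec B (fun s => nat_of_bool (b2 s)) ->
  primrec B (fun s => nat_of_bool (b1 s && b2 s)).
Proof.
move=> H1 H2; apply: eq_primrec (primrec_if H1 H2 (primrec_const 0)).
by move=> s; case: (b1 s).
Qed.

Lemma primrec_orb b1 b2 : primrec B (fun s => nat_of_bool (b1 s)) ->
  primrec B (fun s => nat_of_bool (b2 s)) ->
  primrec B (fun s => nat_of_bool (b1 s || b2 s)).
Proof.
move=> H1 H2; apply: eq_primrec (primrec_if H1 (primrec_const 1) H2).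
by move=> s; case: (b1 s).
Qed.

Lemma primrec_sub e1 e2 : primrec B e1 -> primrec B e2 ->
  primrec B (fun s => e1 s - e2 s).
Proof.
apply: primrec_comp2; have := primrec_iterate (G := fun y _ => y.-1)
  (primrec_pred (primrec_nth B 0)) (primrec_nth B 1) (primrec_nth B 0).
by apply: eq_primrec => s; rewrite -[RHS]/(_ - _); elim: (nth 0 s 1) => [|n IH];
  rewrite ?subn0 // iterS IH subnS.
Qed.

Lemma primrec_add e1 e2 : primrec B e1 -> primrec B e2 ->
  primrec B (fun s => e1 s + e2 s).
Proof.
apply: primrec_comp2; have := primrec_iterate (G := fun y _ => y.+1)
  (primrecS (primrec_nth B 0)) (primrec_nth B 0) (primrec_nth B 1).
by apply: eq_primrec => s; elim: (nth 0 s 0) => // n; rewrite iterS => ->.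
Qed.

Lemma primrec_mul e1 e2 : primrec B e1 -> primrec B e2 ->
  primrec B (fun s => e1 s * e2 s).
Proof.
apply: primrec_comp2; have := primrec_iterate (G := fun y s => nth 0 s 1 + y)
  (primrec_add (primrec_nth_behead 1) (primrec_nth B 0))
  (primrec_nth B 0) (primrec_const 0).
by apply: eq_primrec => s; elim: (nth 0 s 0) => // n; rewrite iterS mulSn => ->.
Qed.

Lemma primrec_expn m e : primrec B e -> primrec B (fun s => m ^ e s).
Proof.
move=> He; have := primrec_iterate (G := fun y _ => m * y)
  (primrec_mul (primrec_const m) (primrec_nth B 0)) He (primrec_const 1).
by apply: eq_primrec => s; elim: (e s) => // n; rewrite iterS expnS => ->.
Qed.

Lemma primrec_leq e1 e2 : primrec B e1 -> primrec B e2 ->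
  primrec B (fun s => nat_of_bool (e1 s <= e2 s)).
Proof.
move=> H1 H2; have := primrec_iterate (G := fun _ _ => 0) (primrec_const 0)
  (primrec_sub H1 H2) (primrec_const 1).
by apply: eq_primrec => s; rewrite /leq; case: (_ - _).
Qed.

Lemma primrec_eq e1 e2 : primrec B e1 -> primrec B e2 ->
  primrec B (fun s => nat_of_bool (e1 s == e2 s)).
Proof.
move=> H1 H2; apply: eq_primrec
  (primrec_andb (primrec_leq H1 H2) (primrec_leq H2 H1)) => s.
by rewrite eqn_leq.
Qed.

End PrimrecClosure.

(* The least [k < n] with [p k], or [n] if there is none. *)
Definition search (p : pred nat) (n : nat) : nat :=
  iter n (fun k => if p k then k else k.+1) 0.

Lemma search_eq p n k :
  k <= n -> (forall i, i < k -> ~~ p i) -> (k < n -> p k) -> search p n = k.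
Proof.
rewrite /search; elim: n k => [|n IH] k kn lo hi; first by move: kn; case: k lo hi.
rewrite iterS; case: (ltngtP k n.+1) kn => // [kn _|-> _] in lo hi *.
  by rewrite (IH k) //= ?hi // => kn'; apply: hi.
by rewrite (IH n) //= ?(negPf (lo n _)) ?ltnn // => i ik; apply: lo; apply: ltnW.
Qed.

Lemma primrec_search B (p : nat -> seq nat -> bool) e :
  primrec B (fun s => nat_of_bool (p (nth 0 s 0) (behead s))) -> primrec B e ->
  primrec B (fun s => search (fun k => p k s) (e s)).
Proof.
move=> Hp He.
apply: (@primrec_iterate B (fun k s => if p k s then k else k.+1)) => //.
  by apply: primrec_if Hp _ _; [|apply: primrecS]; apply: primrec_nth.
exact: primrec_const.
Qed.

Lemma primrec_half B e : primrec B e -> primrec B (fun s => (e s)./2).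
Proof.
apply: (@primrec_comp1 B (fun n => n./2)); set x := fun s => nth 0 s 0.
(* Half of [n] is the least [k] with [n <= 2k+1], found by a bounded search. *)
apply: (@eq_primrec B (fun s => search (fun k => x s <= (k + k).+1) (x s))).
  by move=> s; apply: search_eq => [|i|] /=; rewrite -/(x s); move: (x s); lia.
apply: primrec_search; last exact: primrec_nth.
apply: primrec_leq; first exact: primrec_nth_behead.
by apply/primrecS/primrec_add; apply: primrec_nth.
Qed.

(** * Codes of sequences *)

(** The recursion step of [CodeSeq.code]. It maps pairs bijectively onto the positive numbers, so
    every number codes a sequence, and it doubles as pairing function. *)
Definition consn (a b : nat) : nat := 2 ^ a * b.*2.+1.

(** The 2-adic valuation, as the number of halvings before an odd number appears; the value at [0]
    is [0]. *)
Definition hd (n : nat) : nat := search (fun k => odd (iter k half n)) n.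

Definition tl (n : nat) : nat := (iter (hd n) half n)./2.

Lemma code_cons a s : CodeSeq.code (a :: s) = consn a (CodeSeq.code s).
Proof. by []. Qed.

Lemma iter_half a c k : k <= a -> iter k half (2 ^ a * c) = 2 ^ (a - k) * c.
Proof.
elim: k => [|k IH] ka; first by rewrite subn0.
rewrite iterS IH 1?ltnW // subnS -[a - k]prednK ?subn_gt0 // expnS -mulnA.
by rewrite mul2n doubleK.
Qed.

Lemma hd_cons a b : hd (consn a b) = a.
Proof.
apply: search_eq => [|i ia|_].
- by rewrite (leq_trans (ltnW (ltn_expl a (ltnSn 1)))) // leq_pmulr.
- rewrite iter_half 1?ltnW // -[a - i]prednK ?subn_gt0 // expnS -mulnA mul2n.
  by rewrite odd_double.
by rewrite iter_half // subnn mul1n /= odd_double.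
Qed.

Lemma tl_cons a b : tl (consn a b) = b.
Proof.
by rewrite /tl hd_cons iter_half // subnn mul1n -[_.+1]/(true + _) half_bit_double.
Qed.

Lemma consn_gt0 a b : 0 < consn a b.
Proof. by rewrite muln_gt0 expn_gt0. Qed.

Lemma hd_code s : hd (CodeSeq.code s) = head 0 s.
Proof. by case: s => // a s; rewrite code_cons hd_cons. Qed.

Lemma tl_code s : tl (CodeSeq.code s) = CodeSeq.code (behead s).
Proof. by case: s => // a s; rewrite code_cons tl_cons. Qed.

Lemma code_eq0 s : (CodeSeq.code s == 0) = nilp s.
Proof. by case: s => // a s; rewrite code_cons gtn_eqF ?consn_gt0. Qed.

(** This makes loops over a coded sequence primitive recursive: the code itself bounds the number of
    rounds, and surplus rounds are idle. *)
Lemma size_code s : size s <= CodeSeq.code s.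
Proof.
elim: s => // a s IH; rewrite code_cons /consn /=.
by rewrite (leq_trans (n := (CodeSeq.code s).*2.+1)) ?leq_pmull ?expn_gt0 //; lia.
Qed.

(* The letter [a] of a word is the tape symbol [a.+1]. *)
Definition word_code (w : seq nat) : nat := CodeSeq.code [seq a.+1 | a <- w].

(** The basic traversal of coded sequences: membership, tests on all letters, association lists and
    the choice of an instruction all come from it. *)
Definition dropwhile (p : pred nat) (n : nat) : nat :=
  iter n (fun l => if (l != 0) && p (hd l) then tl l else l) n.

Lemma dropwhile_code p s :
  dropwhile p (CodeSeq.code s) = CodeSeq.code (drop (find (predC p) s) s).
Proof.
rewrite /dropwhile; set F := fun l => _.
have stop l : F l = l -> forall n, iter n F l = l.
  by move=> Fl; elim=> //= n ->.
suff H n : size s <= n ->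
    iter n F (CodeSeq.code s) = CodeSeq.code (drop (find (predC p) s) s).
  exact/H/size_code.
elim: s n => [|a s IH] n sn; first exact: stop.
have Fa : F (CodeSeq.code (a :: s)) = CodeSeq.code (if p a then s else a :: s).
  by rewrite /F code_eq0 hd_code tl_code /=; case: ifP.
case: n sn => // n sn; rewrite iterSr Fa /=; case: ifP Fa => pa Fa /=.
  exact: IH.
exact: stop.
Qed.

Lemma dropwhile_all p s : (dropwhile p (CodeSeq.code s) == 0) = all p s.
Proof.
rewrite dropwhile_code code_eq0 /nilp size_drop subn_eq0 leqNgt -has_find.
by rewrite has_predC negbK.
Qed.

Definition memn (a n : nat) : bool := dropwhile (fun b => b != a) n != 0.

Lemma memn_code a s : memn a (CodeSeq.code s) = (a \in s).
Proof.
rewrite /memn dropwhile_all; elim: s => //= b s IH; rewrite inE negb_and IH.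
by rewrite negbK eq_sym.
Qed.

Section PrimrecCodes.
Variable B : set nat.
Implicit Types e : seq nat -> nat.

Lemma primrec_cons e1 e2 : primrec B e1 -> primrec B e2 ->
  primrec B (fun s => consn (e1 s) (e2 s)).
Proof.
move=> H1 H2; apply: (primrec_mul (primrec_expn 2 H1)).
by apply: eq_primrec (primrecS (primrec_add H2 H2)) => s; rewrite addnn.
Qed.

Lemma primrec_iter_half e1 e2 : primrec B e1 -> primrec B e2 ->
  primrec B (fun s => iter (e1 s) half (e2 s)).
Proof.
move=> H1 H2; apply: (@primrec_iterate B (fun y _ => y./2)) => //.
exact/primrec_half/primrec_nth.
Qed.

Lemma primrec_hd e : primrec B e -> primrec B (fun s => hd (e s)).
Proof.
apply: (@primrec_comp1 B hd); apply: primrec_search; last exact: primrec_nth.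
have H := primrec_iter_half (primrec_nth B 0) (primrec_nth_behead B 0).
have H2 := primrec_half H.
apply: eq_primrec (primrec_negb (primrec_eq H (primrec_add H2 H2))) => s.
by set n := iter _ _ _; rewrite addnn; congr nat_of_bool; lia.
Qed.

Lemma primrec_tl e : primrec B e -> primrec B (fun s => tl (e s)).
Proof.
by move=> He; apply/primrec_half/primrec_iter_half => //; apply: primrec_hd.
Qed.

Lemma primrec_dropwhile (p : nat -> seq nat -> bool) e :
  primrec B (fun s => nat_of_bool (p (nth 0 s 0) (behead s))) -> primrec B e ->
  primrec B (fun s => dropwhile (fun a => p a s) (e s)).
Proof.
move=> Hp He.
pose G l s := if (l != 0) && p (hd l) s then tl l else l.
apply: (@primrec_iterate B G) => //; have H0 := primrec_nth B 0.
apply: primrec_if => //; last exact: primrec_tl.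
apply: primrec_andb; first exact: primrec_negb (primrec_eq H0 (primrec_const B 0)).
exact: primrec_let_behead Hp (primrec_hd H0).
Qed.

End PrimrecCodes.

(* Acts on pairs [consn rest acc]. *)
Definition rev_step (y : nat) : nat :=
  if hd y == 0 then y else consn (tl (hd y)) (consn (hd (hd y)) (tl y)).

(** Needed because a machine that conses the letters as it scans them ends up with the reversed
    input. *)
Definition revn (n : nat) : nat := tl (iter n rev_step (consn n 0)).

Lemma revn_code s : revn (CodeSeq.code s) = CodeSeq.code (rev s).
Proof.
rewrite /revn /rev -[consn _ 0]/(consn (CodeSeq.code s) (CodeSeq.code [::])).
suff H n t : size s <= n ->
    iter n rev_step (consn (CodeSeq.code s) (CodeSeq.code t)) =
    consn 0 (CodeSeq.code (catrev s t)).
  by rewrite H ?tl_cons // size_code.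
elim: s n t => [|a s IH] n t sn.
  rewrite -[RHS]/(consn 0 (CodeSeq.code t)); clear sn; elim: n => // n IH.
  by rewrite iterS IH /rev_step hd_cons.
case: n sn => // n sn; rewrite iterSr.
rewrite {2}/rev_step !hd_cons !tl_cons code_eq0.
exact: (IH n (a :: t) sn).
Qed.

Lemma primrec_rev B e : primrec B e -> primrec B (fun s => revn (e s)).
Proof.
move=> He; apply: primrec_tl.
apply: (@primrec_iterate B (fun y _ => rev_step y)) => //; last first.
  exact: primrec_cons He (primrec_const B 0).
have H0 := primrec_nth B 0; have Hh := primrec_hd H0.
apply: primrec_if => //; first exact: primrec_eq Hh (primrec_const B 0).
by apply: primrec_cons; [apply: primrec_tl | apply: primrec_cons;
  [apply: primrec_hd | apply: primrec_tl]].
Qed.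

(** * Machines that read their input and then search for a witness *)

Section NormalForm.
Variable B : set nat.

Lemma step_end a b p c :
  states_in a b p -> state c = b -> step B (MkTM fset0 p) c = None.
Proof.
move=> inp sc; case E: (step _ _ _) => [c'|//].
by have := step_state inp E; rewrite sc ltnn andbF.
Qed.

Lemma states_in_cat a b p q : a <= b ->
  states_in 0 a p -> states_in a b q -> states_in 0 b (p ++ q).
Proof.
move=> ab inp inq; rewrite /states_in all_cat -/(states_in 0 b p).
by rewrite (states_in_sub _ ab inp) // -/(states_in 0 b q) (states_in_sub _ _ inq).
Qed.

Lemma reaches_catl q a p n c c' : states_in 0 a p ->
  reaches B p n c c' -> reaches B (p ++ q) n c c'.
Proof. by move=> inp; apply: (reaches_cat (p1 := [::]) q inp). Qed.

Lemma reaches_catr a b p q n c c' : states_in 0 a p -> states_in a b q ->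
  reaches B q n c c' -> reaches B (p ++ q) n c c'.
Proof.
move=> inp inq re; have := reaches_cat [::] inq _ re; rewrite cats0; apply.
by apply: states_in_out inp; rewrite leqnn.
Qed.

(** With [z = 1], tape 0 is preserved: it still holds the unread part of the input. *)
Lemma realizable_cons1 c : realizable B 1 (fun m m' => m' 1 = consn c (m 1)).
Proof.
have Hc : primrec B (fun s => consn c (nth 0 s 0)).
  by apply: primrec_cons (primrec_nth B 0); apply: primrec_const.
have He := @primrec_evaluable B 1 _ Hc [:: 1] 2 3 isT isT isT.
have := realizable_seq He (@realizable_move B 1 2 1 isT isT isT).
by apply: realizable_sub => m m' [m1 [/= e _] ->].
Qed.

(** One fragment per letter, for the two letters that unary numbers and binary strings use. Symbols
    are erased as they are read, so tape 0 ends blank and can serve as register 0: [z] drops from 1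
    to 0. *)
Lemma read_input : exists p b, states_in 0 b p /\
  forall w, all (fun a => a <= 1) w -> exists m T n,
    [/\ represents 0 m T, m 1 = CodeSeq.code (rev [seq a.+1 | a <- w]) &
        reaches B p n (init w) (Config b T)].
Proof.
have [p1 [b1 [ab1 in1 run1]]] := realizable_cons1 1 1.
have [p2 [b2 [ab2 in2 run2]]] := realizable_cons1 2 b1.+1.
pose test := [:: Act 0 0 0 0 Stay b2.+1; Act 0 0 1 0 GoRight 1;
                 Act 0 0 2 0 GoRight b1.+1].
pose back1 := [:: Query b1 0 0 0]; pose back2 := [:: Query b2 0 0 0].
pose p := test ++ p1 ++ back1 ++ p2 ++ back2.
exists p, b2.+1; split.
  rewrite /states_in !all_cat -/(states_in _ _ p1) -/(states_in _ _ p2).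
  by rewrite (states_in_sub _ _ in1) ?(states_in_sub _ _ in2) /=; lia.
have out1 : states_out 1 b1 test by rewrite /states_out /=; lia.
have outb1 : states_out b1 b1.+1 (test ++ p1).
  rewrite /states_out all_cat -/(states_out _ _ p1).
  by rewrite (states_in_out _ in1) ?leqnn //=; lia.
have out2 : states_out b1.+1 b2 (test ++ p1 ++ back1).
  rewrite /states_out !all_cat -/(states_out _ _ p1).
  by rewrite (states_in_out _ in1) ?leqnSn //=; lia.
have outb2 : states_out b2 b2.+1 (test ++ p1 ++ back1 ++ p2).
  rewrite /states_out !all_cat -/(states_out _ _ p1) -/(states_out _ _ p2).
  by rewrite (states_in_out _ in1) ?(states_in_out _ in2) //=; lia.
have jump1 T : reaches B p 1 (Config b1 T) (Config 0 T).
  have := @reaches_cat B b1 b1.+1 (test ++ p1) back1 (p2 ++ back2) 1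
    (Config b1 T) (Config 0 T).
  rewrite -!catA => H; apply: H => //; last exact: reaches1 (step_jump _ _ _ _ _ _).
  by rewrite /states_in /=; lia.
have jump2 T : reaches B p 1 (Config b2 T) (Config 0 T).
  have := @reaches_cat B b2 b2.+1 (test ++ p1 ++ back1 ++ p2) back2 [::] 1
    (Config b2 T) (Config 0 T).
  rewrite cats0 -!catA => H; apply: H => //; last exact: reaches1 (step_jump _ _ _ _ _ _).
  by rewrite /states_in /=; lia.
have letter a m T s t : a <= 1 -> represents 1 m T ->
    (forall i, nth 0 (T 0).1 i = 0) -> (T 0).2 = a.+1 :: t ->
    m 1 = CodeSeq.code s -> exists m' T' n,
    [/\ represents 1 m' T', forall i, nth 0 (T' 0).1 i = 0, (T' 0).2 = t,
        m' 1 = CodeSeq.code (a.+1 :: s) & reaches B p n (Config 0 T) (Config 0 T')].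
  move=> a1 rT l0 r0 ms; pose T1 u := if u == 0 then (0 :: (T 0).1, t) else T u.
  have st : step B (MkTM fset0 p) (Config 0 T) =
      Some (Config (if a == 0 then 1 else b1.+1) T1).
    rewrite /p /= !step_cons /= /scanned r0 /=.
    by case: a a1 {r0} => [|[]].
  have rT1 : represents 1 m T1 by move=> [|u] // _; apply: rT.
  have l1 i : nth 0 (T1 0).1 i = 0 by case: i => /=.
  have r1 : (T1 0).2 = t by [].
  case: a a1 {r0} st => [|[]] // _ st.
    have [m' [T' [n [m'1 rT' T'0 re]]]] := run1 m T1 rT1.
    exists m', T', (1 + (n + 1)); rewrite T'0 // m'1 ms; split=> //.
    apply: (reaches_trans (reaches1 st)); apply: reaches_trans (jump1 T').
    exact: reaches_cat in1 out1 re.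
  have [m' [T' [n [m'1 rT' T'0 re]]]] := run2 m T1 rT1.
  exists m', T', (1 + (n + 1)); rewrite T'0 // m'1 ms; split=> //.
  apply: (reaches_trans (reaches1 st)); apply: reaches_trans (jump2 T').
  by have := reaches_cat back2 in2 out2 re; rewrite -!catA.
suff main w s m T : all (fun a => a <= 1) w -> represents 1 m T ->
    (forall i, nth 0 (T 0).1 i = 0) -> (T 0).2 = [seq a.+1 | a <- w] ->
    m 1 = CodeSeq.code s -> exists m' T' n,
    [/\ represents 0 m' T', m' 1 = CodeSeq.code (catrev [seq a.+1 | a <- w] s) &
        reaches B p n (Config 0 T) (Config b2.+1 T')].
  move=> w w1; apply: (main w [::] (fun=> 0)) => //.
    by move=> [|r] // _; split=> i; rewrite nth_nil.
  by move=> i; rewrite nth_nil.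
elim: w s m T => [|a w IH] s m T.
  move=> _ rT l0 r0 ms.
  exists (upd m 0 0), (fun u => if u == 0 then write 0 (T 0) else T u), 1.
  split=> //; last by apply: reaches1; rewrite /p /= step_cons /= /scanned r0.
  move=> [|u] _; rewrite /upd /=; last exact: rT.
  by split=> //= -[|i] //=; rewrite r0 nth_nil.
move=> /andP[a1 w1] rT l0 r0 ms.
have [m1 [T1 [n1 [rT1 l1 r1 m11 re1]]]] := letter _ _ _ _ _ a1 rT l0 r0 ms.
have [m' [T' [n [rT' m'1 re]]]] := IH _ _ _ w1 rT1 l1 r1 m11.
by exists m', T', (n1 + n); split=> //; apply: reaches_trans re.
Qed.

(** The program is chosen before the alphabet [A], so an argument can later be passed through the
    alphabet without changing the program. *)
Lemma search_machine (p : nat -> nat -> bool) (g : nat -> nat -> nat) :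
  primrec B (fun s => nat_of_bool (p (nth 0 s 0) (nth 0 s 1))) ->
  primrec B (fun s => g (nth 0 s 0) (nth 0 s 1)) ->
  exists P, forall A w, all (fun a => a <= 1) w ->
    let v := word_code w in
    (forall n, p n v -> (forall i, i < n -> ~~ p i v) ->
       computes B (MkTM A P) w (g n v)) /\
    (halts B (MkTM A P) w -> exists n, p n v).
Proof.
move=> Hp Hg.
(* The input is available only in reverse, so [p] and [g] are precomposed with [revn]. *)
have Hr := primrec_rev (primrec_nth B 1).
have {}Hp := @primrec_comp2 B (fun n v => p n v) _ _ Hp (primrec_nth B 0) Hr.
have {}Hg := primrec_comp2 Hg (primrec_nth B 0) Hr.
have [p0 [b0 [in0 read_input0]]] := read_input.
(* Register 0 receives the output, 1 holds the reversed input, 2 the candidate, 3 the outcome of the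
   test; the scratch registers start at 4. *)
have [p1 [b1 [ab1 in1 run1]]] := @realizable_zero B 0 2 isT b0.
have [p2 [b2 [ab2 in2 run2]]] :=
  @primrec_evaluable B 0 _ Hp [:: 2; 1] 3 4 isT isT isT b1.
have [p3 [b3 [ab3 in3 run3]]] := @realizable_inc B 0 2 isT b2.+1.
have [p4 [b4 [ab4 in4 run4]]] :=
  @primrec_evaluable B 0 _ Hg [:: 2; 1] 0 4 isT isT isT b3.+1.
pose test := [:: Act b2 3 0 0 Stay b2.+1; Query b2 3 b3.+1 b3.+1].
pose back := [:: Query b3 0 b1 b1].
pose P1 := p0 ++ p1; pose P2 := P1 ++ p2; pose P3 := P2 ++ test.
pose P4 := P3 ++ p3; pose P5 := P4 ++ back; pose P := P5 ++ p4.
have intest : states_in b2 b2.+1 test by rewrite /states_in /=; lia.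
have inback : states_in b3 b3.+1 back by rewrite /states_in /=; lia.
have inP1 := states_in_cat ab1 in0 in1; have inP2 := states_in_cat ab2 inP1 in2.
have inP3 := states_in_cat (leqnSn b2) inP2 intest.
have inP4 := states_in_cat ab3 inP3 in3.
have inP5 := states_in_cat (leqnSn b3) inP4 inback.
have inP := states_in_cat ab4 inP5 in4.
have fromP4 n c c' : reaches B P4 n c c' -> reaches B P n c c'.
  by move=> /(reaches_catl back inP4)/(reaches_catl p4 inP5).
have fromP2 n c c' : reaches B P2 n c c' -> reaches B P n c c'.
  by move=> /(reaches_catl test inP2)/(reaches_catl p3 inP3)/fromP4.
exists P => A w w1 v.
have [m0 [T0 [n0 [rT0 m01 re0]]]] := read_input0 w w1.
have [m1 [T1 [n1 [m1E rT1 _ re1]]]] := run1 _ _ rT0.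
have start : reaches B P (n0 + n1) (init w) (Config b1 T1).
  apply: fromP2; apply: (reaches_catl p2 inP1).
  exact: reaches_trans (reaches_catl p1 in0 re0) (reaches_catr in0 in1 re1).
have m1v : revn (m1 1) = v by rewrite m1E /upd /= m01 revn_code revK.
have test_p m T : represents 0 m T -> revn (m 1) = v ->
  exists m' T' n, [/\ represents 0 m' T', m' 1 = m 1, m' 2 = m 2 &
    reaches B P n.+1 (Config b1 T)
      (Config (if p (m 2) v then b3.+1 else b2.+1) T')].
  move=> rT mv; have [m' [T2 [n [[e H] rT' _ re]]]] := run2 m T rT.
  have sc := num_tape_scanned (rT' 3 isT).
  pose T' := if p (m 2) v then T2
    else fun u => if u == 3 then write 0 (T2 3) else T2 u.
  have st : step B (MkTM fset0 test) (Config b2 T2) =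
      Some (Config (if p (m 2) v then b3.+1 else b2.+1) T').
    rewrite /test !step_cons /= !eqxx sc e /= mv /T'.
    by case: (p _ _); rewrite ?if_same.
  exists m', T', n; split; rewrite ?H //; last first.
    rewrite -addn1; apply: reaches_trans.
      exact/fromP2/(reaches_catr inP1 in2 re).
    apply/fromP4/(reaches_catl p3 inP3); exact: reaches_catr inP2 intest (reaches1 st).
  rewrite /T'; case: ifP => // pm u _.
  case: (eqVneq u 3) => [->|_]; last exact: rT'.
  have [hl hr] := rT' 3 isT; split=> // -[|i] /=; first by rewrite e /= mv pm.
  by rewrite nth_behead hr e /= mv pm.
(* [n <= k] records that every round costs at least one step. *)
have loop n : (forall i, i < n -> ~~ p i v) ->
  exists m T k, [/\ represents 0 m T, revn (m 1) = v, m 2 = n, n <= k &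
    reaches B P k (init w) (Config b1 T)].
  elim: n => [_|n IH pn].
    by exists m1, T1, (n0 + n1); split=> //; rewrite m1E.
  have [|m [T [k [rT mv m2 nk re]]]] := IH; first by move=> i /ltnW /pn.
  have [m' [T' [k' [rT' m'1 m'2 re']]]] := test_p m T rT mv.
  rewrite m2 (negPf (pn n (ltnSn n))) in re'.
  have [m3 [T3 [k3 [m3E rT3 _ re3]]]] := run3 _ _ rT'.
  exists m3, T3, (k + (k'.+1 + (k3 + 1))); split=> //.
  - by rewrite m3E /upd /= -mv -m'1.
  - by rewrite m3E /upd /= m'2 m2.
  - by rewrite addSn addnS ltnS (leq_trans nk) ?leq_addr.
  apply: reaches_trans re _; apply: reaches_trans re' _; apply: reaches_trans.
    exact/fromP4/(reaches_catr inP3 in3 re3).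
  apply: (reaches_catl p4 inP5); apply: (reaches_catr inP4 inback).
  exact: reaches1 (step_jump _ _ _ _ _ _).
split=> [n pn lo|[c [N [itN stc]]]].
  have [m [T [k [rT mv m2 _ re]]]] := loop n lo.
  have [m' [T' [k' [rT' m'1 m'2 re']]]] := test_p m T rT mv.
  rewrite m2 pn in re'.
  have [m4 [T4 [k4 [[e _] rT4 _ re4]]]] := run4 _ _ rT'.
  exists (Config b4 T4); split; last first.
    by rewrite (num_tape_num (rT4 0 isT)) e /= m'2 m2 m'1 mv.
  exists (k + (k'.+1 + k4)); split; last exact: step_end inP _.
  apply: reaches_trans re _; apply: reaches_trans re' _.
  exact: reaches_catr inP5 in4 re4.
(* Without a witness, round [N.+1] is reached after more than [N] steps, although the machine halted
   at time [N]. *)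
apply: contrapT => nop.
have [i _|m [T [k [_ _ _ Nk re]]]] := loop N.+1.
  by apply/negP => pi; apply: nop; exists i.
move: re; rewrite /reaches -(subnK Nk) addnS -addSn iterD.
have -> : iter N (obind (step B (MkTM fset0 P))) (Some (init w)) = Some c.
  exact: itN.
rewrite iterSr /= -[step _ _ c]/(step B (MkTM A P) c) stc.
suff -> j F : iter j (obind F) (@None config) = None by [].
by elim: j => //= j ->.
Qed.

End NormalForm.

(** * An interpreter of oracle machines *)

#[local] Hint Resolve primrec_nth primrec_nth_behead primrec_const primrecS
  primrec_pred primrec_if primrec_negb primrec_andb primrec_orb primrec_leq
  primrec_eq primrec_add primrec_cons primrec_hd primrec_tl primrec_oracle
  primrec_search primrec_dropwhile : primrec.

Ltac primrec := cbv beta; auto 30 with primrec nocore.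

Definition nthn (k n : nat) : nat := hd (iter k tl n).

Lemma nthn_code k s : nthn k (CodeSeq.code s) = nth 0 s k.
Proof.
rewrite /nthn; elim: k s => [|k IH] s; first by rewrite hd_code nth0.
by rewrite iterSr tl_code IH nth_behead.
Qed.

Lemma primrec_nthn B e1 e2 : primrec B e1 -> primrec B e2 ->
  primrec B (fun s => nthn (e1 s) (e2 s)).
Proof.
move=> H1 H2; apply: primrec_hd.
by apply: (@primrec_iterate B (fun y _ => tl y)) => //; primrec.
Qed.
#[local] Hint Resolve primrec_nthn : primrec.

Lemma dropwhile_cons p a b :
  dropwhile p (consn a b) = if p a then dropwhile p b else consn a b.
Proof.
rewrite -[b]CodeSeq.decodeK -code_cons !dropwhile_code /=.
by case: (p a).
Qed.

(* The tapes of a configuration are coded by an association list, in which a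
   missing tape is blank. *)
Definition lookup (l u : nat) : nat := tl (hd (dropwhile (fun e => hd e != u) l)).

Lemma lookup_cons u x l v :
  lookup (consn (consn u x) l) v = if v == u then x else lookup l v.
Proof.
rewrite /lookup dropwhile_cons hd_cons [v == u]eq_sym.
by case: eqP => /=; rewrite ?hd_cons ?tl_cons.
Qed.

Lemma primrec_lookup B e1 e2 : primrec B e1 -> primrec B e2 ->
  primrec B (fun s => lookup (e1 s) (e2 s)).
Proof.
apply: primrec_comp2; apply/primrec_tl/primrec_hd.
by apply: (@primrec_dropwhile B (fun e s => hd e != nth 0 s 1)); primrec.
Qed.
#[local] Hint Resolve primrec_lookup : primrec.

(** Stated through [hd] and [tl], so that [0], the result of looking up a missing tape, codes the
    blank tape. *)
Definition codes_tape (n : nat) (t : tape) : Prop :=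
  hd n = CodeSeq.code t.1 /\ tl n = CodeSeq.code t.2.

Definition writen (b n : nat) : nat := consn (hd n) (consn b (tl (tl n))).

Definition moven (d n : nat) : nat :=
  if d == 0 then consn (tl (hd n)) (consn (hd (hd n)) (tl n))
  else if d == 1 then n else consn (consn (hd (tl n)) (hd n)) (tl (tl n)).

Definition tape_numn (n : nat) : nat := search (fun k => nthn k (tl n) == 0) (tl n).

Lemma codes_write b n t : codes_tape n t -> codes_tape (writen b n) (write b t).
Proof.
by move=> [El Er]; rewrite /codes_tape /writen hd_cons tl_cons El Er tl_code.
Qed.

Lemma codes_move d n t :
  codes_tape n t -> codes_tape (moven (direction_code d) n) (move d t).
Proof.
move=> [El Er]; rewrite /codes_tape /moven.
by case: d => //=; rewrite hd_cons tl_cons El Er !hd_code !tl_code.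
Qed.

Lemma codes_scanned n t : codes_tape n t -> hd (tl n) = scanned t.
Proof. by move=> [_ ->]; rewrite hd_code. Qed.

Lemma codes_tape_num n t : codes_tape n t -> tape_numn n = tape_num t.
Proof.
move=> [_ Er]; rewrite /tape_numn Er; apply: search_eq.
- exact: leq_trans (find_size _ _) (size_code _).
- by move=> i /(before_find 0) /=; rewrite nthn_code => ->.
(* If no blank is listed, [find] returns the size of the list, where the default of [nth] supplies
   the blank. *)
move=> _; rewrite nthn_code /tape_num; case: (ltnP (find (pred1 0) t.2) (size t.2)).
  by rewrite -has_find => /(nth_find 0).
by move/(nth_default 0) ->.
Qed.

Section Interpreter.
Variable B : set nat.

Definition codes_config (k : nat) (c : config) : Prop :=
  hd k = state c /\ forall u, codes_tape (lookup (tl k) u) (tapes c u).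

Definition applicablen (k i : nat) : bool :=
  (hd k == nthn 1 i) &&
  ((nthn 0 i != 0) || (hd (tl (lookup (tl k) (nthn 2 i))) == nthn 3 i)).

(** A changed tape is pushed as a new entry, which shadows the older entry for the same tape. *)
Definition execn (k i : nat) : nat :=
  if nthn 0 i == 0 then
    consn (nthn 6 i) (consn (consn (nthn 2 i)
      (moven (nthn 5 i) (writen (nthn 4 i) (lookup (tl k) (nthn 2 i))))) (tl k))
  else consn (if `[< B (tape_numn (lookup (tl k) (nthn 2 i))) >] then nthn 3 i
              else nthn 4 i) (tl k).

Definition applicable_from (p k : nat) : nat :=
  dropwhile (fun i => ~~ applicablen k i) p.

(** Idle on halted configurations: runs are total, and [haltsn] stays true once it holds. *)
Definition stepn (p k : nat) : nat :=
  if applicable_from p k == 0 then k else execn k (hd (applicable_from p k)).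

Definition initn (v : nat) : nat := consn 0 (consn (consn 0 (consn 0 v)) 0).

Definition runn (e v n : nat) : nat := iter n (stepn (tl e)) (initn v).

Definition haltsn (e v n : nat) : bool :=
  applicable_from (tl e) (runn e v n) == 0.

Definition outputn (e v n : nat) : nat := tape_numn (lookup (tl (runn e v n)) 0).

Lemma primrec_tape_numn e : primrec B e -> primrec B (fun s => tape_numn (e s)).
Proof.
apply: (@primrec_comp1 B tape_numn).
by apply: (@primrec_search B (fun k s => nthn k (tl (nth 0 s 0)) == 0)); primrec.
Qed.

Lemma primrec_applicable_from e1 e2 : primrec B e1 -> primrec B e2 ->
  primrec B (fun s => applicable_from (e1 s) (e2 s)).
Proof.
apply: primrec_comp2.
apply: (@primrec_dropwhile B (fun i s => ~~ applicablen (nth 0 s 1) i)).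
  by rewrite /applicablen; primrec.
exact: primrec_nth.
Qed.

Lemma primrec_stepn e1 e2 : primrec B e1 -> primrec B e2 ->
  primrec B (fun s => stepn (e1 s) (e2 s)).
Proof.
have Hw e e' : primrec B e -> primrec B e' ->
  primrec B (fun s => writen (e s) (e' s)) by rewrite /writen; primrec.
have Hm e e' : primrec B e -> primrec B e' ->
  primrec B (fun s => moven (e s) (e' s)) by rewrite /moven; primrec.
have Hn := primrec_tape_numn; have Hf := primrec_applicable_from.
have He e e' : primrec B e -> primrec B e' ->
    primrec B (fun s => execn (e s) (e' s)).
  by rewrite /execn; primrec.
by rewrite /stepn; primrec.
Qed.

Lemma codes_init x :
  codes_config (initn (word_code x)) (init x).
Proof.
split=> [|u]; first by rewrite hd_cons.
rewrite tl_cons lookup_cons /init /=; case: eqP => _ //.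
by rewrite /codes_tape hd_cons tl_cons.
Qed.

Lemma codes_applicable k c i :
  codes_config k c -> applicablen k (instr_code i) = applicable c i.
Proof.
move=> [Es Et]; rewrite /applicablen Es.
case: i => [q t a b d q'|q t q1 q0]; rewrite /instr_code !nthn_code /= ?andbT //.
by rewrite (codes_scanned (Et t)).
Qed.

Lemma codes_exec k c i :
  codes_config k c -> codes_config (execn k (instr_code i)) (exec B c i).
Proof.
move=> [Es Et]; rewrite /execn.
case: i => [q t a b d q'|q t q1 q0]; rewrite /instr_code !nthn_code /=.
  split=> [|u]; rewrite ?hd_cons // tl_cons lookup_cons /=.
  by case: eqP => _ //; apply/codes_move/codes_write.
by split=> [|u]; rewrite ?hd_cons ?tl_cons // (codes_tape_num (Et t)).
Qed.

Lemma codes_step A p k c : codes_config k c ->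
  let P := CodeSeq.code [seq instr_code i | i <- p] in
  if step B (MkTM A p) c is Some c' then
    applicable_from P k <> 0 /\ codes_config (stepn P k) c'
  else applicable_from P k = 0.
Proof.
move=> Ek; rewrite /step /stepn /=; elim: p => [|i p IH] //=.
rewrite -[2 ^ _ * _]/(consn _ _) /applicable_from dropwhile_cons.
rewrite (codes_applicable i Ek); case: ifP => //= _.
have := consn_gt0 (instr_code i) (CodeSeq.code [seq instr_code i | i <- p]).
case: eqP => [-> //|nz _]; split=> //.
by rewrite hd_cons; apply: codes_exec.
Qed.

Lemma codes_stepTM M k c : codes_config k c ->
  if step B M c is Some c' then
    applicable_from (tl (TM_code M)) k <> 0 /\
    codes_config (stepn (tl (TM_code M)) k) c'
  else applicable_from (tl (TM_code M)) k = 0.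
Proof. by case: M => A p /(codes_step A p); rewrite /TM_code code_cons tl_cons. Qed.

Lemma runnS e v n : runn e v n.+1 = stepn (tl e) (runn e v n).
Proof. by []. Qed.

Lemma codes_run M x n c :
  iter n (obind (step B M)) (Some (init x)) = Some c ->
  codes_config (runn (TM_code M) (word_code x) n) c.
Proof.
elim: n c => [|n IH] c; first by case=> <-; apply: codes_init.
rewrite runnS iterS; case E: (iter n _ _) => [c1|] //= st.
by have := codes_stepTM M (IH _ E); rewrite st => -[].
Qed.

(** The second alternative arises because the coded run keeps repeating the final configuration
    after the machine has halted. *)
Lemma run_codes M x n :
  let k := runn (TM_code M) (word_code x) n in
  exists2 c, codes_config k c &
    iter n (obind (step B M)) (Some (init x)) = Some c \/ halts_in B M x c.
Proof.
elim: n => [|n [c kc Hc]]; first by exists (init x); [apply: codes_init | left].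
rewrite runnS; set k := runn _ _ n in kc *.
have := codes_stepTM M kc; case E: (step B M c) => [c'|].
  move=> [_ kc']; exists c' => //; case: Hc => [it|[j [_ stc]]].
    by left; rewrite iterS it.
  by rewrite stc in E.
move=> nz; exists c; first by rewrite /stepn nz.
by right; case: Hc => // it; exists n.
Qed.

Lemma halts_in_codes M x n : 
  let e := TM_code M in let v := word_code x in
  haltsn e v n -> exists2 c, halts_in B M x c & outputn e v n = tape_num (tapes c 0).
Proof.
move=> e v /eqP hn; have [c kc Hc] := run_codes M x n; exists c; last first.
  by rewrite /outputn (codes_tape_num (kc.2 0)).
case: Hc => // it; exists n; split=> //; have := codes_stepTM M kc.
by rewrite hn; case: step => // c' [].
Qed.

Lemma codes_halts_in M x c :
  let e := TM_code M in let v := word_code x in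
  halts_in B M x c -> exists2 n, haltsn e v n & outputn e v n = tape_num (tapes c 0).
Proof.
move=> e v [n [it st]]; have kc := codes_run it; exists n.
  by have := codes_stepTM M kc; rewrite st /haltsn => ->.
by rewrite /outputn (codes_tape_num (kc.2 0)).
Qed.

(* [e] is the code of a machine and [v] that of the content of its input tape. *)
Definition halting (e v : nat) : Prop := exists n, haltsn e v n.

Definition computing (e v y : nat) : Prop :=
  exists n, haltsn e v n && (outputn e v n == y).

Lemma haltingP M x :
  halts B M x <-> halting (TM_code M) (word_code x).
Proof.
split=> [[c /codes_halts_in[n hn _]]|[n /halts_in_codes[c hc _]]].
  by exists n.
by exists c.
Qed.

Lemma computingP M x y :
  computes B M x y <-> computing (TM_code M) (word_code x) y.
Proof.
split=> [[c [/codes_halts_in[n hn on] <-]]|[n /andP[/halts_in_codes[c hc ->]]]].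
  by exists n; rewrite hn on eqxx.
by move=> /eqP <-; exists c.
Qed.

Lemma computes_inj M x y y' : computes B M x y -> computes B M x y' -> y = y'.
Proof.
move=> [c [[n [it st]] <-]] [c' [[n' [it' st']] <-]]; congr (tape_num (tapes _ 0)).
suff main j j' d d' : j <= j' ->
    iter j (obind (step B M)) (Some (init x)) = Some d -> step B M d = None ->
    iter j' (obind (step B M)) (Some (init x)) = Some d' -> d = d'.
  by case/orP: (leq_total n n') => le; [|symmetry]; apply: main le _ _ _.
move=> le itd std; rewrite -(subnK le) iterD itd; case: (j' - j) => [[]//|k].
rewrite iterSr /= std; suff -> : iter k (obind (step B M)) None = None by [].
by elim: k => //= k ->.
Qed.

Lemma primrec_runn e1 e2 e3 : primrec B e1 -> primrec B e2 -> primrec B e3 ->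
  primrec B (fun s => runn (e1 s) (e2 s) (e3 s)).
Proof.
apply: primrec_comp3; apply: (@primrec_iterate B (fun y s => stepn (tl (nth 0 s 0)) y)).
- by apply: primrec_stepn; primrec.
- by primrec.
by rewrite /initn; primrec.
Qed.

Lemma primrec_haltsn e1 e2 e3 : primrec B e1 -> primrec B e2 -> primrec B e3 ->
  primrec B (fun s => nat_of_bool (haltsn (e1 s) (e2 s) (e3 s))).
Proof.
move=> H1 H2 H3; apply: primrec_eq; last exact: primrec_const.
by apply: primrec_applicable_from; [apply: primrec_tl | apply: primrec_runn].
Qed.

Lemma primrec_outputn e1 e2 e3 : primrec B e1 -> primrec B e2 -> primrec B e3 ->
  primrec B (fun s => outputn (e1 s) (e2 s) (e3 s)).
Proof.
move=> H1 H2 H3; apply: primrec_tape_numn; apply: primrec_lookup; last exact: primrec_const.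
by apply/primrec_tl/primrec_runn.
Qed.

End Interpreter.

(** * Relatively enumerable predicates and Post's theorem *)

(** Kleene normal form; the primitive recursive matrix keeps machines out of the closure proofs. *)
Definition enumerable (B : set nat) (X : nat -> Prop) : Prop :=
  exists2 p : nat -> nat -> bool,
    primrec B (fun s => nat_of_bool (p (nth 0 s 0) (nth 0 s 1))) &
    forall x, X x <-> exists n, p n x.

Section Enumerable.
Variable B : set nat.
Implicit Types X Y : nat -> Prop.

Lemma eq_enumerable X Y : (forall x, X x <-> Y x) -> enumerable B X -> enumerable B Y.
Proof. by move=> XY [p Hp pX]; exists p => // x; rewrite -XY. Qed.

Lemma enumerable_bool (b : nat -> bool) :
  primrec B (fun s => nat_of_bool (b (nth 0 s 0))) -> enumerable B (fun x => b x).
Proof.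
move=> Hb; exists (fun _ x => b x); last by move=> x; split=> [bx|[_ //]]; exists 0.
exact: (@primrec_comp1 B (fun x => nat_of_bool (b x))) Hb (primrec_nth B 1).
Qed.

Lemma enumerable_comp X g : primrec B (fun s => g (nth 0 s 0)) ->
  enumerable B X -> enumerable B (fun x => X (g x)).
Proof.
move=> Hg [p Hp pX]; exists (fun n x => p n (g x)) => [|x]; last exact: pX.
apply: (@primrec_comp2 B (fun n x => nat_of_bool (p n x))) Hp (primrec_nth B 0) _.
exact: primrec_comp1 Hg (primrec_nth B 1).
Qed.

(** Relations of several arguments are treated as predicates of a pair; this substitutes terms for
    the two components. *)
Lemma enumerable_app2 (X : nat -> nat -> Prop) g1 g2 :
  enumerable B (fun x => X (hd x) (tl x)) ->
  primrec B (fun s => g1 (nth 0 s 0)) -> primrec B (fun s => g2 (nth 0 s 0)) ->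
  enumerable B (fun x => X (g1 x) (g2 x)).
Proof.
move=> HX H1 H2; have := enumerable_comp (g := fun x => consn (g1 x) (g2 x)) _ HX.
move=> /(_ (primrec_cons H1 H2)); apply: eq_enumerable => x.
by rewrite hd_cons tl_cons.
Qed.

Lemma enumerable_app3 (X : nat -> nat -> nat -> Prop) g1 g2 g3 :
  enumerable B (fun x => X (hd x) (hd (tl x)) (tl (tl x))) ->
  primrec B (fun s => g1 (nth 0 s 0)) -> primrec B (fun s => g2 (nth 0 s 0)) ->
  primrec B (fun s => g3 (nth 0 s 0)) ->
  enumerable B (fun x => X (g1 x) (g2 x) (g3 x)).
Proof.
move=> HX H1 H2 H3; have := @enumerable_app2
  (fun a b => X a (hd b) (tl b)) g1 (fun x => consn (g2 x) (g3 x)) HX H1.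
move=> /(_ (primrec_cons H2 H3)); apply: eq_enumerable => x.
by rewrite hd_cons tl_cons.
Qed.

Lemma enumerable_and X Y :
  enumerable B X -> enumerable B Y -> enumerable B (fun x => X x /\ Y x).
Proof.
move=> [p Hp pX] [q Hq qY]; exists (fun n x => p (hd n) x && q (tl n) x).
  apply: primrec_andb.
    apply: (@primrec_comp2 B (fun n x => nat_of_bool (p n x))) Hp _ _; primrec.
  apply: (@primrec_comp2 B (fun n x => nat_of_bool (q n x))) Hq _ _; primrec.
move=> x; rewrite pX qY; split=> [[[n pn] [m qm]]|[n /andP[pn qn]]].
  by exists (consn n m); rewrite hd_cons tl_cons pn.
by split; [exists (hd n) | exists (tl n)].
Qed.

Lemma enumerable_or X Y :
  enumerable B X -> enumerable B Y -> enumerable B (fun x => X x \/ Y x).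
Proof.
move=> [p Hp pX] [q Hq qY]; exists (fun n x => p n x || q n x).
  exact: primrec_orb.
move=> x; rewrite pX qY; split=> [[[n pn]|[n qn]]|[n /orP[pn|qn]]].
- by exists n; rewrite pn.
- by exists n; rewrite qn orbT.
- by left; exists n.
by right; exists n.
Qed.

Lemma enumerable_ex (X : nat -> nat -> Prop) :
  enumerable B (fun x => X (hd x) (tl x)) ->
  enumerable B (fun x => exists y, X y x).
Proof.
move=> [p Hp pX]; exists (fun n x => p (hd n) (consn (tl n) x)).
  by apply: (@primrec_comp2 B (fun n x => nat_of_bool (p n x))) Hp _ _; primrec.
move=> x; split=> [[y]|[n]].
  rewrite -[y](hd_cons y x) -{2}[x](tl_cons y x) => /pX[n pn].
  by exists (consn n y); rewrite hd_cons tl_cons.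
move=> pn; exists (tl n); rewrite -[tl n](hd_cons _ x) -{2}[x](tl_cons (tl n) x).
by apply/pX; exists (hd n).
Qed.

Lemma enumerable_halting e1 e2 :
  primrec B (fun s => e1 (nth 0 s 0)) -> primrec B (fun s => e2 (nth 0 s 0)) ->
  enumerable B (fun x => halting B (e1 x) (e2 x)).
Proof.
move=> H1 H2; exists (fun n x => haltsn B (e1 x) (e2 x) n) => //.
apply: primrec_haltsn; last exact: primrec_nth.
  exact: primrec_comp1 H1 (primrec_nth B 1).
exact: primrec_comp1 H2 (primrec_nth B 1).
Qed.

Lemma enumerable_computing e1 e2 e3 :
  primrec B (fun s => e1 (nth 0 s 0)) -> primrec B (fun s => e2 (nth 0 s 0)) ->
  primrec B (fun s => e3 (nth 0 s 0)) ->
  enumerable B (fun x => computing B (e1 x) (e2 x) (e3 x)).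
Proof.
move=> H1 H2 H3.
exists (fun n x => haltsn B (e1 x) (e2 x) n && (outputn B (e1 x) (e2 x) n == e3 x)) => //.
have {}H1 := primrec_comp1 H1 (primrec_nth B 1).
have {}H2 := primrec_comp1 H2 (primrec_nth B 1).
have {}H3 := primrec_comp1 H3 (primrec_nth B 1).
apply: primrec_andb; first exact: primrec_haltsn H1 H2 (primrec_nth B 0).
exact: primrec_eq (primrec_outputn H1 H2 (primrec_nth B 0)) H3.
Qed.

Lemma first_witness (p : pred nat) n : p n ->
  exists2 k, p k & forall i, i < k -> ~~ p i.
Proof.
move=> pn; case: (ex_minnP (ex_intro _ n pn)) => k pk kmin; exists k => // i.
by rewrite ltnNge; apply: contra => /kmin.
Qed.

(* The machine receives [x] as its input alphabet [{x}], which it reads off its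
   own code; thus no machine has to be constructed by another one. *)
Lemma enumerable_jump X : enumerable B X ->
  exists2 g, forall A, primrec A (fun s => g (nth 0 s 0)) &
             forall x, X x <-> jump B (g x).
Proof.
move=> [p Hp pX].
pose len v := search (fun k => nthn k v == 0) v.
have Hlen : primrec B (fun s => len (nth 0 s 0)).
  apply: (@primrec_search B (fun k s => nthn k (nth 0 s 0) == 0)); primrec.
have lenE n : len (word_code (unary n)) = n.
  apply: search_eq.
  - by rewrite (leq_trans _ (size_code _)) // size_map size_nseq.
  - by move=> i lt; rewrite nthn_code (nth_map 0) ?size_nseq.
  by move=> _; rewrite nthn_code nth_default // size_map size_nseq.
(* The input of interest is the machine's own code in unary. [len] recovers that code, its [hd]
   codes the alphabet, and the [hd] of this is the only letter [x]. *)
have [] := @search_machine B (fun n v => p n (hd (hd (len v)))) (fun _ _ => 0).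
- apply: (@primrec_comp2 B (fun n x => nat_of_bool (p n x))) Hp _ _; first exact: primrec_nth.
  exact/primrec_hd/primrec_hd/(primrec_comp1 Hlen)/primrec_nth.
- exact: primrec_const.
move=> P PP; pose K := CodeSeq.code [seq instr_code i | i <- P].
exists (fun x => consn (consn x 0) K) => [A|x]; first by primrec.
have codeE : TM_code (MkTM [fset x]%fset P) = consn (consn x 0) K.
  by rewrite /TM_code enum_fsetE enum_fset1.
have [] := PP [fset x]%fset (unary (consn (consn x 0) K)).
  by apply/allP => a /nseqP[->].
rewrite /= lenE !hd_cons => run halt; rewrite pX; split=> [[n pn]|].
  exists (MkTM [fset x]%fset P) => //.
  have [k pk kmin] := @first_witness (fun n => p n x) n pn.
  by have [c [hc _]] := run k pk kmin; exists c.
move=> [M eM hM]; apply/halt/haltingP; rewrite codeE.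
by move/haltingP: hM; rewrite -eM.
Qed.

(** A predicate enumerable in [B] costs a single query to [jump B], and may then occur under
    negations and bounded quantifiers. *)
Lemma primrec_enumerable X e : enumerable B X -> primrec (jump B) e ->
  primrec (jump B) (fun s => nat_of_bool `[< X (e s) >]).
Proof.
move=> /enumerable_jump[g Hg Xg] He.
apply: eq_primrec (primrec_oracle (primrec_comp1 (Hg (jump B)) He)) => s.
by congr nat_of_bool; apply: asbool_equiv_eq; rewrite Xg.
Qed.

End Enumerable.

Section Post.
Variable B : set nat.
Implicit Types X Y : nat -> Prop.

Lemma enumerable_jumpW X : enumerable B X -> enumerable (jump B) X.
Proof.
move=> /primrec_enumerable/(_ (primrec_nth _ 0)) HX.
by apply: eq_enumerable (enumerable_bool (b := fun x => `[< X x >]) HX) => x; rewrite asboolE.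
Qed.

Lemma enumerable_jumpN X : enumerable B X -> enumerable (jump B) (fun x => ~ X x).
Proof.
move=> /primrec_enumerable/(_ (primrec_nth _ 0))/primrec_negb HX.
apply: eq_enumerable (enumerable_bool (b := fun x => ~~ `[< X x >]) HX) => x.
by split=> /asboolPn.
Qed.

(** The quantifier holds exactly when the bounded search for a counterexample runs up to its
    bound. *)
Lemma enumerable_ltn_all (b : nat -> nat -> bool) g :
  primrec B (fun s => nat_of_bool (b (nth 0 s 0) (nth 0 s 1))) ->
  primrec B (fun s => g (nth 0 s 0)) ->
  enumerable B (fun x => forall d, d < g x -> b d x).
Proof.
move=> Hb Hg; pose srch x := search (fun d => ~~ b d x) (g x).
have Hs : primrec B (fun s => nat_of_bool (g (nth 0 s 0) <= srch (nth 0 s 0))).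
  apply: (primrec_leq Hg).
  apply: (@primrec_search B (fun d s => ~~ b d (nth 0 s 0)) _ _ Hg).
  apply: primrec_negb.
  by apply: (@primrec_comp2 B (fun d x => nat_of_bool (b d x))) Hb _ _; primrec.
apply: eq_enumerable (enumerable_bool (b := fun x => g x <= srch x) Hs) => x.
split=> [le d dg|H].
  apply: contraLR le => bd; rewrite -ltnNge.
  have [k bk kmin] := first_witness (p := fun d => ~~ b d x) bd.
  have kd : k <= d by rewrite leqNgt; apply/negP => /kmin; rewrite bd.
  rewrite /srch (search_eq (k := k)) //; first exact: leq_ltn_trans dg.
  exact: ltnW (leq_ltn_trans kd dg).
by rewrite /srch (search_eq (k := g x)) ?ltnn // => i /H ->.
Qed.

(** Both enumerations advance in parallel to the first stage at which one succeeds; they cannot both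
    succeed, so the value of [p] at that stage is the answer. *)
Lemma decide_set (X : set (seq bool)) (Y N : nat -> Prop) :
  enumerable B Y -> enumerable B N ->
  (forall D, X D <-> Y (word_code (bits D))) ->
  (forall D, ~ X D <-> N (word_code (bits D))) ->
  set_recursive_in B X.
Proof.
move=> [p Hp pY] [q Hq qN] XY XN.
have [] := @search_machine B (fun n v => p n v || q n v) (fun n v => p n v).
- exact: primrec_orb.
- exact: Hp.
move=> P PP; exists (MkTM fset0 P) => D.
have [|run _] := PP fset0 (bits D); first by apply/allP => a /mapP[[] _ ->].
have pX n : p n (word_code (bits D)) -> X D by move=> pn; apply/XY/pY; exists n.
have qX n : q n (word_code (bits D)) -> ~ X D by move=> qn; apply/XN/qN; exists n.
have [n pqn] : exists n, p n (word_code (bits D)) || q n (word_code (bits D)).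
  have [/XY/pY[n pn]|/XN/qN[n qn]] := EM (X D); exists n; first by rewrite pn.
  by rewrite qn orbT.
have [k pqk kmin] := @first_witness (fun n => p n _ || q n _) n pqn.
have -> : `[< X D >] = p k (word_code (bits D)); last exact: run.
case/orP: pqk => pk; last first.
  case pk' : (p k _); first by have := qX _ pk (pX _ pk').
  by apply/asboolPn/qX/pk.
by rewrite pk; apply/asboolP/pX/pk.
Qed.

End Post.

(** * Descriptional systems *)

#[local] Hint Resolve enumerable_ex enumerable_and enumerable_or
  enumerable_computing enumerable_bool : primrec.

Lemma language_eq (L L' : language) :
  alph L = alph L' -> (forall w, words L w <-> words L' w) -> L = L'.
Proof.
case: L L' => [A X XA] [A' X' XA'] /= AA XX; subst A'.
have EX : X = X' by apply/funext => w; apply/propext.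
by subst X'; congr MkLanguage; apply: Prop_irrelevance.
Qed.

Definition input (D : seq bool) : nat := word_code (bits D).

(** Candidates range over all numbers, whereas the machines of a system are specified on binary
    strings only; this is the filter. The bits 0 and 1 are the symbols 1 and 2. *)
Definition is_input (v : nat) : bool :=
  dropwhile (fun b => (b == 1) || (b == 2)) v == 0.

Lemma is_inputP v : is_input v <-> exists D, v = input D.
Proof.
rewrite -[v]CodeSeq.decodeK /is_input dropwhile_all.
split=> [H|[D /(can_inj CodeSeq.codeK) ->]]; last first.
  by rewrite !all_map; apply/allP => -[].
exists [seq a == 2 | a <- CodeSeq.decode v]; rewrite /input /word_code /bits.
rewrite -!map_comp; congr CodeSeq.code; elim: (CodeSeq.decode v) H => //= a s IH.
by case/andP=> /orP[]/eqP-> /IH {1}->.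
Qed.

Definition is_word_over (A v : nat) : bool :=
  dropwhile (fun b => (b != 0) && memn b.-1 A) v == 0.

Lemma is_word_overP s v :
  is_word_over (CodeSeq.code s) v <-> exists2 w, v = word_code w & all (mem s) w.
Proof.
rewrite -[v]CodeSeq.decodeK /is_word_over dropwhile_all.
under eq_all do rewrite memn_code.
split=> [H|[w /(can_inj CodeSeq.codeK) -> H]]; last by rewrite all_map.
exists [seq a.-1 | a <- CodeSeq.decode v]; last first.
  by rewrite all_map; apply: sub_all H => a /andP[].
rewrite /word_code -map_comp; congr CodeSeq.code.
by elim: (CodeSeq.decode v) H => //= -[|a] t IH //= /andP[_ /IH {1}->].
Qed.

Lemma computing_bits M D y y' : computes set0 M (bits D) y ->
  computing set0 (TM_code M) (input D) y' <-> y' = y.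
Proof.
move=> cy; split=> [/computingP/computes_inj|->]; first exact.
exact/computingP.
Qed.

Lemma finite_bounded (T : eqType) (g : T -> nat) (A : set T) :
  finite_set A -> exists k, forall x, A x -> g x <= k.
Proof.
move=> /finite_seqP[s ->]; exists (\max_(x <- s) g x) => x /= xs.
by rewrite (leq_bigmax_seq x).
Qed.

(** A finite union of finite sets. Mere existence of [k] suffices, since the procedure will search
    for it and verify it with the oracle. *)
Lemma bounded_complexity S c A n : complexity_measure S c ->
  exists k, forall D, descriptors_over S A D -> c D <= n -> input D <= k.
Proof.
move=> [_ _ fin]; elim: n => [|n [k IH]].
  have [k H] := finite_bounded input (fin A 0).
  by exists k => D SD; rewrite leqn0 => /eqP c0; apply: H.
have [k' H] := finite_bounded input (fin A n.+1).
exists (maxn k k') => D SD; rewrite leq_eqVlt leq_max => /orP[/eqP cn|cn].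
  by rewrite H ?orbT.
by rewrite IH.
Qed.

(** A finite set has a canonical enumeration, so alphabets can be compared through their codes. *)
Lemma same_alphabetP M M' :
  hd (TM_code M) = hd (TM_code M') <-> tm_alph M = tm_alph M'.
Proof.
rewrite /TM_code !code_cons !hd_cons; split=> [/(can_inj CodeSeq.codeK) E|-> //].
by apply/fsetP => a; rewrite -[a \in _]/(a \in enum_fset _) E.
Qed.

(** * The decision procedure, uniformly for deciders and semi-deciders *)

Section Ness.
Variables (B : set nat) (P : TM -> language -> Prop) (acc rej : nat -> nat -> Prop).
Hypothesis enumB : forall X, enumerable set0 X -> enumerable B X.
Hypothesis enum_acc : enumerable B (fun x => acc (hd x) (tl x)).
Hypothesis enum_rej : enumerable B (fun x => rej (hd x) (tl x)).
Hypothesis P_alph : forall N L, P N L -> tm_alph N = alph L.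
Hypothesis P_acc : forall N L w, P N L -> word_over (alph L) w ->
  (acc (TM_code N) (word_code w) <-> words L w) /\
  (rej (TM_code N) (word_code w) <-> ~ words L w).
Variables (S1 S2 : desc_system) (c1 c2 : seq bool -> nat) (f : nat -> nat).
Hypothesis conv1 : effective_conversion P (ds_set S1) (ds_lang S1).
Hypothesis conv2 : effective_conversion P (ds_set S2) (ds_lang S2).
Hypothesis hc1 : complexity_measure S1 c1.
Hypothesis hc2 : complexity_measure S2 c2.
Hypothesis hf : upper_bound S1 S2 c1 c2 f.
Hypothesis hfr : fun_recursive_in (jump B) f.

Lemma ness_recursive : set_recursive_in (jump B) (ness S2 S1).
Proof.
have [MS1 hS1] := ds_set_recursive S1; have [MS2 hS2] := ds_set_recursive S2.
have [[M1 hM1] _ _] := hc1; have [[M2 hM2] _ _] := hc2.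
have [C1 hC1] := conv1; have [C2 hC2] := conv2; have [F hF] := hfr.
have inS1 D : computing set0 (TM_code MS1) (input D) 1 <-> ds_set S1 D.
  by rewrite (computing_bits _ (hS1 D)); case: asboolP.
have outS1 D : computing set0 (TM_code MS1) (input D) 0 <-> ~ ds_set S1 D.
  by rewrite (computing_bits _ (hS1 D)); case: asboolP.
have inS2 D : computing set0 (TM_code MS2) (input D) 1 <-> ds_set S2 D.
  by rewrite (computing_bits _ (hS2 D)); case: asboolP.
(* Alphabets are accessible only through the machines that the conversions return, hence the
   comparison of [hd N1] with [hd N2]. *)
pose good v d n := exists k N1 N2, is_input d /\
  computing set0 (TM_code MS2) d 1 /\
  computing set0 (TM_code M2) d k /\ k <= n /\
  computing set0 (TM_code C1) v N1 /\ computing set0 (TM_code C2) d N2 /\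
  hd N1 == hd N2.
(* The witness is confined to words over the alphabet, where [acc] and [rej] are known to be
   complementary. *)
pose diff v d := exists N1 N2 w,
  computing set0 (TM_code C1) v N1 /\ computing set0 (TM_code C2) d N2 /\
  is_word_over (hd N1) w /\ (acc N1 w /\ rej N2 w \/ rej N1 w /\ acc N2 w).
have enum_good : enumerable set0 (fun x => good (hd x) (hd (tl x)) (tl (tl x))).
  by rewrite /good /is_input; primrec.
have enum_diff : enumerable B (fun x => diff (hd x) (tl x)).
  rewrite /diff; do 3 apply: enumerable_ex; cbv beta.
  apply: enumerable_and; first by apply: enumB; primrec.
  apply: enumerable_and; first by apply: enumB; primrec.
  apply: enumerable_and; first by rewrite /is_word_over /memn; primrec.
  apply: enumerable_or; apply: enumerable_and.
  - by apply: (@enumerable_app2 B acc) enum_acc _ _; primrec.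
  - by apply: (@enumerable_app2 B rej) enum_rej _ _; primrec.
  - by apply: (@enumerable_app2 B rej) enum_rej _ _; primrec.
  by apply: (@enumerable_app2 B acc) enum_acc _ _; primrec.
have goodP D1 d n : ds_set S1 D1 -> good (input D1) d n <->
    exists D2, [/\ d = input D2, descriptors_over S2 (alph (ds_lang S1 D1)) D2 &
                   c2 D2 <= n].
  move=> SD1; have [N1 cN1 PN1] := hC1 _ SD1; split.
    move=> [k [N1' [N2' [/is_inputP[D2 ->]]]]].
    move=> [/inS2 SD2 [ck [kn [cN1' [cN2' /eqP NN]]]]].
    have [N2 cN2 PN2] := hC2 _ SD2; exists D2.
    rewrite (computing_bits _ cN1) in cN1'; rewrite (computing_bits _ cN2) in cN2'.
    rewrite (computing_bits _ (hM2 _ SD2)) in ck.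
    split=> //; last by rewrite -ck.
    split=> //; rewrite -(P_alph PN1) -(P_alph PN2); symmetry.
    by apply/same_alphabetP; rewrite -cN1' -cN2'.
  move=> [D2 [-> [SD2 alphE] c2n]]; have [N2 cN2 PN2] := hC2 _ SD2.
  exists (c2 D2), (TM_code N1), (TM_code N2); split; first by apply/is_inputP; exists D2.
  split; first exact/inS2.
  split; first by apply/(computing_bits _ (hM2 _ SD2)).
  split=> //; split; first exact/(computing_bits _ cN1).
  split; first exact/(computing_bits _ cN2).
  by apply/eqP/same_alphabetP; rewrite (P_alph PN1) (P_alph PN2).
have diffP D1 D2 : ds_set S1 D1 -> descriptors_over S2 (alph (ds_lang S1 D1)) D2 ->
    diff (input D1) (input D2) <-> ds_lang S1 D1 <> ds_lang S2 D2.
  move=> SD1 [SD2 alphE].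
  have [N1 cN1 PN1] := hC1 _ SD1; have [N2 cN2 PN2] := hC2 _ SD2.
  have wordP w : is_word_over (hd (TM_code N1)) w <->
      exists2 u, w = word_code u & word_over (alph (ds_lang S1 D1)) u.
    by rewrite /TM_code code_cons hd_cons is_word_overP -(P_alph PN1).
  split.
    move=> [N1' [N2' [w [cN1' [cN2' [wo ar]]]]]] L12.
    rewrite (computing_bits _ cN1) in cN1'; rewrite (computing_bits _ cN2) in cN2'.
    subst N1' N2'; have [u wu uo] := (wordP w).1 wo; subst w.
    have [a1 r1] := P_acc PN1 uo; rewrite -alphE in uo.
    have [a2 r2] := P_acc PN2 uo.
    by move: ar; rewrite a1 r1 a2 r2 L12 => -[[]|[]].
  move=> L12; have [w ww] : exists w,
      ~ (words (ds_lang S1 D1) w <-> words (ds_lang S2 D2) w).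
    by apply/existsNP => H; apply/L12/language_eq.
  have wo : word_over (alph (ds_lang S1 D1)) w.
    (* A word that is not over the common alphabet lies in neither language, so it cannot separate
       them. *)
    apply: contrapT => nwo; apply: ww; split=> /words_over //.
    by rewrite alphE.
  exists (TM_code N1), (TM_code N2), (word_code w).
  split; first exact/(computing_bits _ cN1).
  split; first exact/(computing_bits _ cN2).
  split; first by apply/wordP; exists w.
  have [-> ->] := P_acc PN1 wo; rewrite -alphE in wo.
  have [-> ->] := P_acc PN2 wo.
  have [W1|W1] := EM (words (ds_lang S1 D1) w); last first.
    right; split=> //; apply: contrapT => W2; apply: ww; split=> //.
  by left; split=> // W2; apply: ww.
set J := jump B.
have lift X : enumerable set0 X -> enumerable J X.
  by move=> HX; apply/enumerable_jumpW/enumB.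
(* [F] takes its argument in unary; this is the code of that input tape, computed from the number
   [c]. *)
pose un c := iter c (consn 1) 0.
have unE c : un c = word_code (unary c).
  by elim: c => // c IH; rewrite /un iterS -/(un c) IH.
have Hun e : primrec J e -> primrec J (fun s => un (e s)).
  by move=> He; apply: (@primrec_iterate J (fun y _ => consn 1 y)); primrec.
have fJ c n : computing J (TM_code F) (un c) n <-> n = f c.
  rewrite unE -computingP; split=> [Fn|->]; last exact: hF.
  exact: computes_inj Fn (hF c).
pose tail v n k := exists d, k < d /\ good v d n.
have enum_tail : enumerable set0 (fun x => tail (hd x) (hd (tl x)) (tl (tl x))).
  apply/enumerable_ex/enumerable_and; first by primrec.
  by apply: (enumerable_app3 enum_good); primrec.
(* A boolean, because the bounded quantifier needs a test primitive recursive in [J]; there is one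
   since [good] and [diff] are enumerable in [B]. *)
pose ok v d n := ~~ `[< good v d n >] || `[< diff v d >].
have enum_ok : enumerable J (fun x =>
    forall d, d < (tl (tl x)).+1 -> ok (hd x) d (hd (tl x))).
  apply: (@enumerable_ltn_all J (fun d x => ok (hd x) d (hd (tl x)))); last by primrec.
  apply: primrec_orb.
    have := primrec_enumerable (enumB enum_good)
      (e := fun s => consn (hd (nth 0 s 1)) (consn (nth 0 s 0) (hd (tl (nth 0 s 1))))).
    move=> /(_ ltac:(primrec)) H; apply/primrec_negb/(eq_primrec _ H) => s.
    by rewrite !(hd_cons, tl_cons).
  have := primrec_enumerable enum_diff
      (e := fun s => consn (hd (nth 0 s 1)) (nth 0 s 0)).
  move=> /(_ ltac:(primrec)) H; apply: (eq_primrec _ H) => s.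
  by rewrite hd_cons tl_cons.
pose yes v := computing set0 (TM_code MS1) v 1 /\ exists c n d,
  computing set0 (TM_code M1) v c /\ computing J (TM_code F) (un c) n /\
  good v d n /\ ~ diff v d.
(* [tail] covers the candidates [d > k], so [d < k.+1] covers exactly the others. *)
pose no v := computing set0 (TM_code MS1) v 0 \/
  (computing set0 (TM_code MS1) v 1 /\ exists c n k,
   computing set0 (TM_code M1) v c /\ computing J (TM_code F) (un c) n /\
   ~ tail v n k /\ forall d, d < k.+1 -> ok v d n).
have enum_yes : enumerable J yes.
  apply: enumerable_and; first by apply: lift; primrec.
  do 3 apply: enumerable_ex; cbv beta.
  apply: enumerable_and; first by apply: lift; primrec.
  apply: enumerable_and; first by primrec.
  apply: enumerable_and; first by apply: (enumerable_app3 (lift _ enum_good)); primrec.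
  apply: (@enumerable_app2 J (fun v d => ~ diff v d) _ _
    (enumerable_jumpN enum_diff)); primrec.
have enum_no : enumerable J no.
  apply: enumerable_or; first by apply: lift; primrec.
  apply: enumerable_and; first by apply: lift; primrec.
  do 3 apply: enumerable_ex; cbv beta.
  apply: enumerable_and; first by apply: lift; primrec.
  apply: enumerable_and; first by primrec.
  apply: enumerable_and.
    apply: (@enumerable_app3 J (fun v n k => ~ tail v n k) _ _ _
      (enumerable_jumpN (enumB enum_tail))); primrec.
  apply: (@enumerable_app3 J (fun v n k => forall d, d < k.+1 -> ok v d n)
    _ _ _ enum_ok); primrec.
have yesP D : yes (input D) -> ness S2 S1 D.
  move=> [/inS1 SD [c [n [d [_ [_ [/(goodP _ _ _ SD)[D2 [-> OD2 _]] ndiff]]]]]]].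
  split=> //; exists D2; first by case: OD2.
  by apply: contrapT => L12; apply/ndiff/(diffP _ _ SD OD2) => L21; apply: L12.
have noP D : no (input D) -> ~ ness S2 S1 D.
  move=> [/outS1 nSD [SD _] //|[/inS1 SD [c [n [k [cc [fn [nt all_ok]]]]]]]] [_ nD].
  rewrite (computing_bits _ (hM1 _ SD)) in cc; subst c; move/fJ: fn => fn; subst n.
  have [D2 [SD2 L12] c2f] := hf.2 _ SD nD.
  have OD2 : descriptors_over S2 (alph (ds_lang S1 D)) D2 by rewrite -L12.
  have gD : good (input D) (input D2) (f (c1 D)) by apply/(goodP _ _ _ SD); exists D2.
  (* The equivalent descriptor promised by [f] is a candidate: beyond [k] it contradicts the empty
     tail, and up to [k] it would have to describe another language. *)
  have [kd|dk] := ltnP k (input D2); first by apply: nt; exists (input D2).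
  have := all_ok _ dk; rewrite /ok => /orP[/asboolPn //|/asboolP].
  by move=> /(diffP _ _ SD OD2); apply.
have nessP D : ness S2 S1 D -> yes (input D).
  move=> [SD nD]; split; first exact/inS1.
  have [D2 [SD2 L12] c2f] := hf.2 _ SD nD.
  have OD2 : descriptors_over S2 (alph (ds_lang S1 D)) D2 by rewrite -L12.
  exists (c1 D), (f (c1 D)), (input D2).
  split; first exact/(computing_bits _ (hM1 _ SD)).
  split; first exact/fJ.
  split; first by apply/(goodP _ _ _ SD); exists D2.
  by move=> /(diffP _ _ SD OD2); apply.
have nnessP D : ~ ness S2 S1 D -> no (input D).
  move=> nnD; have [SD|nSD] := EM (ds_set S1 D); last by left; apply/outS1.
  right; split; first exact/inS1.
  have [k Hk] := bounded_complexity (alph (ds_lang S1 D)) (f (c1 D)) hc2.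
  exists (c1 D), (f (c1 D)), k.
  split; first exact/(computing_bits _ (hM1 _ SD)).
  split; first exact/fJ.
  split.
    move=> [d [kd /(goodP _ _ _ SD)[D2 [dE OD2 c2f]]]].
    by have := Hk _ OD2 c2f; rewrite -dE leqNgt kd.
  move=> d _; rewrite /ok; case: asboolP => //= /(goodP _ _ _ SD)[D2 [-> OD2 _]].
  apply/asboolP/(diffP _ _ SD OD2) => L12; apply: nnD; split=> //.
  by exists D2; first by case: OD2.
apply: (decide_set enum_yes enum_no) => D.
  by split; [apply: nessP | apply: yesP].
by split; [apply: nnessP | apply: noP].
Qed.

End Ness.

Theorem theorem3 (S1 S2 : desc_system) (c1 c2 : seq bool -> nat)
    (hc1 : complexity_measure S1 c1) (hc2 : complexity_measure S2 c2)
    (hne : (described_languages S1 `&` described_languages S2) !=set0)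
    (f : nat -> nat) (hf : upper_bound S1 S2 c1 c2 f) :
  (recursive_system S1 /\ recursive_system S2 ->
     fun_recursive_in (jump set0) f ->
     set_recursive_in (jump set0) (ness S2 S1))
  /\
  (~ recursive_system S1 \/ ~ recursive_system S2 ->
     fun_recursive_in (jump (jump set0)) f ->
     set_recursive_in (jump (jump set0)) (ness S2 S1)).
Proof.
split=> [[r1 r2]|_] fJ.
  (* A decider halts with 1 or 0, so acceptance and rejection are both enumerable without an
     oracle. *)
  apply: (@ness_recursive set0 decides (fun e w => computing set0 e w 1)
    (fun e w => computing set0 e w 0)) (ds_decider r1) (ds_decider r2) hc1 hc2 hf fJ => //.
  - by primrec.
  - by primrec.
  - by move=> N L [].
  move=> N L w [_ dN] /dN cN.
  split; split.
  - by move=> /computingP/(computes_inj cN); case: asboolP.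
  - by move=> W; apply/computingP; rewrite asboolT // in cN.
  - by move=> /computingP/(computes_inj cN); case: asboolP.
  by move=> W; apply/computingP; rewrite asboolF // in cN.
have Hh : enumerable set0 (fun x => halting set0 (hd x) (tl x)).
  by apply: enumerable_halting; primrec.
(* Rejection by a semi-decider is non-halting, enumerable in the first jump; this base oracle leads
   to the second jump. *)
apply: (@ness_recursive (jump set0) semidecides (halting set0)
  (fun e w => ~ halting set0 e w)) (ds_semidecider (ds_re (d:=S1)))
  (ds_semidecider (ds_re (d:=S2))) hc1 hc2 hf fJ.
- by move=> X; apply: enumerable_jumpW.
- exact: enumerable_jumpW.
- exact: enumerable_jumpN.
- by move=> N L [].
move=> N L w [_ sN] /sN hN; have HW := iff_trans (iff_sym (haltingP set0 N w)) hN.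
by split=> //; split=> H /HW.
Qed.
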